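(* Let $A$ and $B$ be two vector spaces over a field of characteristic $0$. Let $\mathfrak a=\bigoplus_{n\ge0}\mathfrak a_n$ with $\mathfrak a_n=\mathrm{Hom}(A^{\otimes n+1},B)$, and let $\mathscr Q$ be the graded Lie algebra defined in the context. Then $(\mathscr Q[1]\oplus\mathfrak a,\{\widetilde l_k\}_{k=1}^\infty)$ is an $L_\infty$-algebra, where $$\widetilde l_1(F[1],f)=P(F),\qquad \widetilde l_2(F[1],G[1])=(-1)^{|F|}[F,G][1],$$ $$\widetilde l_k(F[1],f_1,\ldots,f_{k-1})=P[\cdots[[F,f_1],f_2],\ldots,f_{k-1}],\quad k\ge2,$$ for all homogeneous $F,G\in\mathscr Q$ and $f,f_1,\ldots,f_{k-1}\in\mathfrak a$, and, up to permutation of the entries (by graded symmetry), all other components of the maps $\widetilde l_k$ vanish.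
   Context: Let $\mathfrak g=\bigoplus_{n\ge0}\mathfrak g_n$, $\mathfrak g_n=\mathrm{Hom}((A\oplus B)^{\otimes n+1},A\oplus B)$, be the graded Lie algebra with the Gerstenhaber bracket: for $f$ with $m$ inputs and $g$ with $n$ inputs, $[f,g]=f\diamond g-(-1)^{(m-1)(n-1)}g\diamond f$, where $(f\diamond g)(v_1,\ldots,v_{m+n-1})=\sum_{i=1}^m(-1)^{(i-1)(n-1)}f(v_1,\ldots,v_{i-1},g(v_i,\ldots,v_{i+n-1}),v_{i+n},\ldots,v_{m+n-1})$. Maps $A^{\otimes n+1}\to B$ are regarded as elements of $\mathfrak g_n$ by extending them by zero, so $\mathfrak a\subset\mathfrak g$; $P:\mathfrak g\to\mathfrak a$ is the projection, i.e. for $F\in\mathfrak g_n$, $P(F)$ is the $B$-component of $F|_{A^{\otimes n+1}}$. Let $\mathcal A^{k,l}$ be the direct sum of all $(k+l)$-fold tensor products of $A$'s and $B$'s in which $A$ appears $k$ times and $B$ appears $l$ times. For $k,l\ge-1$ with $k+l=n$, $C^{k|l}\subset\mathfrak g_n$ is the space of maps $f$ with $f(\mathcal A^{k+1,l})\subset A$, $f(\mathcal A^{k,l+1})\subset B$ and $f=0$ on all other components. Put $\mathscr Q_n=C^{n+1|-1}\oplus C^{n|0}\oplus\cdots\oplus C^{0|n}\subset\mathfrak g_n$; $\mathscr Q=\bigoplus_{n\ge0}\mathscr Q_n$ is a graded Lie subalgebra of $\mathfrak g$. The degree shift is $(\mathscr Q[1])_n=\mathscr Q_{n+1}$; $F\in\mathscr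 Q$ viewed in $\mathscr Q[1]$ is written $F[1]$, and $|F|$ is the degree of $F$ in $\mathscr Q$ (so $|F|=n$ if $F\in\mathscr Q_n$). An $L_\infty$-algebra is a graded vector space $\mathcal G$ with graded symmetric (with Koszul sign $\epsilon(\sigma)$) degree $1$ maps $l_k:\mathcal G^{\otimes k}\to\mathcal G$, $k\ge1$, such that for all $N\ge1$ and homogeneous $x_1,\ldots,x_N$: $\sum_{i=1}^N\sum_{\sigma\in Sh(i,N-i)}\epsilon(\sigma)\,l_{N-i+1}(l_i(x_{\sigma(1)},\ldots,x_{\sigma(i)}),x_{\sigma(i+1)},\ldots,x_{\sigma(N)})=0$, where $Sh(i,N-i)$ is the set of $(i,N-i)$-shuffles. *)

(* Defs.v *)
(* mathcomp.classical provides the module structure on function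
   spaces and subtypes cut out by a Prop-valued predicate. *)
From HB Require Import structures.
From mathcomp Require Import all_boot all_order all_algebra all_fingroup.
From mathcomp Require Import boolp functions.

Set Implicit Arguments.
Unset Strict Implicit.
Unset Printing Implicit Defensive.

Import GRing.Theory.
Local Open Scope ring_scope.

(* A family (f_k)_k of maps with k inputs is one function on words, f_k being
   its restriction to the words of length k. *)
Definition multilinear (K : fieldType) (V W : lmodType K) (f : seq V -> W) :=
  forall (s t : seq V) (a : K) (u v : V),
    f (s ++ (a *: u + v) :: t) = a *: f (s ++ u :: t) + f (s ++ v :: t).

(* The direct sum over n >= 0 of Hom(V^{(x) n+1}, W): no component without
   inputs, and only finitely many nonzero components. *)
Definition is_mhom (K : fieldType) (V W : lmodType K) : pred (seq V -> W) :=
  fun f => `[< [/\ f [::] = 0, multilinear f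
                 & exists N : nat, forall s, (N < size s)%N -> f s = 0] >].

Lemma is_mhom_submod_closed (K : fieldType) (V W : lmodType K) :
  submod_closed (@is_mhom K V W).
Proof.
split=> [|a f g].
  apply/asboolP; split=> //; last by exists 0%N.
  by move=> s t b u v; rewrite scaler0 addr0.
move=> /asboolP[f0 fl [M fM]] /asboolP[g0 gl [N gN]]; apply/asboolP; split.
- by rewrite addrfctE scalrfctE f0 g0 scaler0 addr0.
- move=> s t b u v; rewrite !addrfctE !scalrfctE fl gl !scalerDr !scalerA.
  by rewrite (mulrC a b) addrACA.
- exists (maxn M N) => s; rewrite gtn_max => /andP[hM hN].
  by rewrite addrfctE scalrfctE fM // gN // scaler0 addr0.
Qed.

HB.instance Definition _ (K : fieldType) (V W : lmodType K) :=
  GRing.isSubmodClosed.Build K (seq V -> W) (@is_mhom K V W)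
    (@is_mhom_submod_closed K V W).

Record mhom (K : fieldType) (V W : lmodType K) :=
  Mhom { mhom_fun :> seq V -> W; _ : is_mhom mhom_fun }.

HB.instance Definition _ (K : fieldType) (V W : lmodType K) :=
  [isSub for @mhom_fun K V W].
HB.instance Definition _ (K : fieldType) (V W : lmodType K) :=
  [Choice of mhom V W by <:].
HB.instance Definition _ (K : fieldType) (V W : lmodType K) :=
  [SubChoice_isSubLmodule of mhom V W by <:].

(* [gr d] is the subspace of homogeneous elements of degree [d]; [V] is the
   internal direct sum of these subspaces. *)
Record grading (K : fieldType) (V : lmodType K) := Grading {
  homog :> int -> V -> Prop;
  homog0 : forall d, homog d 0;
  homogP : forall d a x y, homog d x -> homog d y -> homog d (a *: x + y);
  homog_gen : forall x, exists r : seq V,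
    (forall y, y \in r -> exists d, homog d y) /\ x = \sum_(y <- r) y;
  homog_indep : forall (ds : seq int) (c : int -> V), uniq ds ->
    (forall d, homog d (c d)) -> \sum_(d <- ds) c d = 0 ->
    forall d, d \in ds -> c d = 0 }.

Definition homogeneous (K : fieldType) (V : lmodType K) (gr : grading V)
  (x : V) := exists d, gr d x.

Section ShiftSum.
Context (K : fieldType) (V W : lmodType K) (gV : grading V) (gW : grading W).

Lemma shift_gen (x : V) : exists r : seq V,
  (forall y, y \in r -> exists d, gV (d + 1) y) /\ x = \sum_(y <- r) y.
Proof.
have [r [hr ->]] := homog_gen gV x.
by exists r; split=> // y /hr[d hd]; exists (d - 1); rewrite subrK.
Qed.

Lemma shift_indep (ds : seq int) (c : int -> V) : uniq ds ->
  (forall d, gV (d + 1) (c d)) -> \sum_(d <- ds) c d = 0 ->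
  forall d, d \in ds -> c d = 0.
Proof.
move=> uds hc s0 d dds.
rewrite -[d](addrK 1).
apply: (@homog_indep _ _ gV [seq e + 1 | e <- ds] (fun e => c (e - 1))).
- by rewrite map_inj_uniq //; exact: addIr.
- by move=> e; rewrite -{1}[e](subrK 1).
- by rewrite big_map -[RHS]s0; apply: eq_bigr => e _; rewrite addrK.
- exact: map_f.
Qed.

(* V[1]_d = V_{d+1} *)
Definition shift : grading V :=
  @Grading K V (fun d => gV (d + 1)) (fun d => homog0 gV (d + 1))
    (fun d => @homogP K V gV (d + 1)) shift_gen shift_indep.

Let dsum_homog (d : int) (x : V * W) := gV d x.1 /\ gW d x.2.

Lemma dsum0 d : dsum_homog d 0.
Proof. by split; apply: homog0. Qed.

Lemma dsumP d a x y :
  dsum_homog d x -> dsum_homog d y -> dsum_homog d (a *: x + y).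
Proof. by move=> [x1 x2] [y1 y2]; split; apply: homogP. Qed.

Lemma pair_sum (I : Type) (r : seq I) (c : I -> V * W) :
  \sum_(i <- r) c i = (\sum_(i <- r) (c i).1, \sum_(i <- r) (c i).2).
Proof.
elim: r => [|i r ih]; first by rewrite !big_nil.
by rewrite !big_cons ih; case: (c i).
Qed.

Lemma dsum_gen x : exists r : seq (V * W),
  (forall y, y \in r -> exists d, dsum_homog d y) /\ x = \sum_(y <- r) y.
Proof.
have [r1 [h1 e1]] := homog_gen gV x.1; have [r2 [h2 e2]] := homog_gen gW x.2.
exists ([seq (y, 0) | y <- r1] ++ [seq (0, y) | y <- r2]); split.
  move=> y; rewrite mem_cat => /orP[] /mapP[z hz ->].
    by have [d hd] := h1 _ hz; exists d; split=> //; exact: homog0.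
  by have [d hd] := h2 _ hz; exists d; split=> //; exact: homog0.
rewrite big_cat !big_map !pair_sum /= !big1_eq -e1 -e2.
by rewrite [x]surjective_pairing; congr pair; rewrite /= ?addr0 ?add0r.
Qed.

Lemma dsum_indep (ds : seq int) (c : int -> V * W) : uniq ds ->
  (forall d, dsum_homog d (c d)) -> \sum_(d <- ds) c d = 0 ->
  forall d, d \in ds -> c d = 0.
Proof.
move=> uds hc; rewrite pair_sum => -[s1 s2] d dds.
rewrite [c d]surjective_pairing; congr pair.
- by apply: (@homog_indep _ _ gV ds (fun e => (c e).1)) => // e; case: (hc e).
- by apply: (@homog_indep _ _ gW ds (fun e => (c e).2)) => // e; case: (hc e).
Qed.

Definition dsum : grading (V * W)%type := Grading dsum0 dsumP dsum_gen dsum_indep.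

End ShiftSum.

Section MhomGrading.
Context (K : fieldType) (V W : lmodType K).

Definition mhom_homog (d : int) (f : mhom V W) :=
  forall s : seq V, (size s)%:Z != d + 1 -> f s = 0.

Lemma mhom_homog0 d : mhom_homog d 0.
Proof. by []. Qed.

Lemma mhom_homogP d a f g :
  mhom_homog d f -> mhom_homog d g -> mhom_homog d (a *: f + g).
Proof.
move=> hf hg s hs.
by rewrite -[LHS]/(a *: f s + g s) hf // hg // scaler0 addr0.
Qed.

Lemma mhom_sumE (I : Type) (r : seq I) (c : I -> mhom V W) (s : seq V) :
  (\sum_(i <- r) c i) s = \sum_(i <- r) c i s.
Proof.
elim: r => [|i r ih]; first by rewrite !big_nil.
by rewrite !big_cons -ih.
Qed.

Lemma mhom_comp_subproof (d : int) (f : mhom V W) :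
  is_mhom (fun s => if (size s)%:Z == d + 1 then f s else 0).
Proof.
case: f => f /= /asboolP[f0 fl [M fM]]; apply/asboolP; split.
- by rewrite f0 if_same.
- move=> s t a u v; rewrite !size_cat /=.
  by case: ifP => // _; rewrite scaler0 addr0.
- by exists M => s hs; rewrite fM // if_same.
Qed.

Definition mhom_comp d f : mhom V W := Mhom (mhom_comp_subproof d f).

Lemma mhom_gen f : exists r : seq (mhom V W),
  (forall g, g \in r -> exists d, mhom_homog d g) /\ f = \sum_(g <- r) g.
Proof.
have /asboolP[f0 fl [M fM]] : is_mhom f := valP f.
exists [seq mhom_comp (Posz n) f | n <- iota 0 M]; split.
  by move=> _ /mapP[n _ ->]; exists n%:Z => s /negbTE /= ->.
apply: val_inj; apply/funext => s /=; rewrite mhom_sumE big_map /=.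
case: s => [|v s]; first by rewrite f0 big1 // => i _; rewrite if_same.
have [hs|hs] := ltnP M (size (v :: s)).
  by rewrite [LHS]fM // big1 // => i _; rewrite fM // if_same.
rewrite (@bigD1_seq _ _ _ _ _ (size s)) ?iota_uniq ?mem_iota //.
have -> : (size (v :: s))%:Z = (size s)%:Z + 1 by rewrite /= -addn1 PoszD.
rewrite eqxx /= big1 ?addr0 // => i /negbTE ne.
by rewrite (inj_eq (addIr _)) eqz_nat eq_sym ne.
Qed.

Lemma mhom_indep (ds : seq int) (c : int -> mhom V W) : uniq ds ->
  (forall d, mhom_homog d (c d)) -> \sum_(d <- ds) c d = 0 ->
  forall d, d \in ds -> c d = 0.
Proof.
move=> uds hc s0 d dds; apply: val_inj; apply/funext => s /=.
have [hs|hs] := eqVneq (size s)%:Z (d + 1); last by rewrite hc.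
have := congr1 (fun f : mhom V W => f s) s0.
rewrite mhom_sumE (bigD1_seq d) //= big1 ?addr0 // => e ne.
by apply: hc; rewrite hs (inj_eq (addIr _)) eq_sym.
Qed.

(* maps with n+1 inputs have degree n *)
Definition mhom_grading : grading (mhom V W) :=
  Grading mhom_homog0 mhom_homogP mhom_gen mhom_indep.

End MhomGrading.

Section Gerstenhaber.
Context (K : fieldType) (V : lmodType K).

(* f_p <> g_q, where f_p (resp. g_q) is the component of f (resp. g) with p+1
   (resp. q+1) inputs; meaningful on words of length p+q+1. *)
Definition diamond (f g : seq V -> V) (p q : nat) (s : seq V) : V :=
  \sum_(0 <= i < p.+1) (-1 : K) ^+ (i * q) *:
     f (take i s ++ g (take q.+1 (drop i s)) :: drop (i + q.+1) s).

(* Bilinear extension of the bracket of homogeneous elements: on a word of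
   length n+1, sum over all pairs of degrees (p, q) with p + q = n. *)
Definition bracket (f g : seq V -> V) (s : seq V) : V :=
  \sum_(0 <= p < size s) let q := ((size s).-1 - p)%N in
     (diamond f g p q s - (-1 : K) ^+ (p * q) *: diamond g f q p s).

End Gerstenhaber.

Definition emb (U W : nmodType) (x : U + W) : U * W :=
  match x with inl u => (u, 0) | inr w => (0, w) end.

Section AB.
Context (K : fieldType) (A B : lmodType K).

Local Notation V := (A * B)%type.

Definition extend (f : seq A -> B) (s : seq V) : V := (0, f [seq v.1 | v <- s]).

Definition P (F : seq V -> V) (s : seq A) : B := (F [seq (a, 0) | a <- s]).2.

(* f lies in C^{k|l}.  A word [w] in the letters of A and B with [p] letters in
   A and [q] letters in B is a pure tensor in a summand of $\mathcal A^{p,q}$. *)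
Definition inC (k l : int) (f : mhom V V) : Prop :=
  mhom_homog (k + l) f /\
  forall w : seq (A + B),
    let p := (count (fun x => is_inl x) w)%:Z in
    let q := (count (fun x => ~~ is_inl x) w)%:Z in
    let fw := f [seq emb x | x <- w] in
    [/\ (p, q) = (k + 1, l) -> fw.2 = 0,
        (p, q) = (k, l + 1) -> fw.1 = 0
      & (p, q) <> (k + 1, l) -> (p, q) <> (k, l + 1) -> fw = 0].

(* Q_n = C^{n+1|-1} + C^{n|0} + ... + C^{0|n} *)
Definition inQn (n : nat) (f : mhom V V) : Prop :=
  exists c : nat -> mhom V V,
    (forall j, (j < n.+2)%N -> inC (n.+1%:Z - j%:Z) (j%:Z - 1) (c j)) /\
    f = \sum_(0 <= j < n.+2) c j.

(* Q is the sum of the subspaces Q_n. *)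
Definition inQ : pred (mhom V V) := fun f =>
  `[< exists r : seq (mhom V V),
        (forall g, g \in r -> exists n, inQn n g) /\ f = \sum_(g <- r) g >].

Lemma inC0 k l : inC k l 0.
Proof. by split=> // w p q fw; split. Qed.

Lemma inCP k l a f g : inC k l f -> inC k l g -> inC k l (a *: f + g).
Proof.
move=> [hf Cf] [hg Cg]; split; first exact: mhom_homogP.
move=> w p q fw; have [f1 f2 f3] := Cf w; have [g1 g2 g3] := Cg w.
rewrite {}/fw; set v := [seq _ | _ <- _] in f1 f2 f3 g1 g2 g3 *.
rewrite -[mhom_fun (a *: f + g) v]/(a *: f v + g v).
split=> [e|e|e1 e2] /=.
- by rewrite f1 // g1 // scaler0 addr0.
- by rewrite f2 // g2 // scaler0 addr0.
- by rewrite f3 // g3 // scaler0 addr0.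
Qed.

Lemma inQn0 n : inQn n 0.
Proof. by exists (fun=> 0); split=> [j _|]; [exact: inC0|rewrite big1]. Qed.

Lemma inQnP n a f g : inQn n f -> inQn n g -> inQn n (a *: f + g).
Proof.
move=> [c [hc ->]] [e [he ->]]; exists (fun j => a *: c j + e j); split.
  by move=> j hj; apply: inCP; [exact: hc|exact: he].
by rewrite big_split -scaler_sumr.
Qed.

Lemma inQ_submod_closed : submod_closed inQ.
Proof.
split=> [|a f g]; first by apply/asboolP; exists [::]; rewrite big_nil.
move=> /asboolP[r [hr ->]] /asboolP[t [ht ->]]; apply/asboolP.
exists ([seq a *: h | h <- r] ++ t); split; last first.
  by rewrite big_cat big_map -scaler_sumr.
move=> h; rewrite mem_cat => /orP[/mapP[h' /hr[n hn] ->]|/ht //].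
by exists n; rewrite -[a *: h']addr0; apply: inQnP => //; exact: inQn0.
Qed.

HB.instance Definition _ :=
  GRing.isSubmodClosed.Build K (mhom V V) inQ inQ_submod_closed.

Record Q := MkQ { Q_mhom :> mhom V V; _ : inQ Q_mhom }.

HB.instance Definition _ := [isSub for Q_mhom].
HB.instance Definition _ := [Choice of Q by <:].
HB.instance Definition _ := [SubChoice_isSubLmodule of Q by <:].

Definition Q_homog (d : int) (F : Q) := mhom_homog d (F : mhom V V).

Lemma Q_homog0 d : Q_homog d 0.
Proof. by []. Qed.

Lemma Q_homogP d a F G : Q_homog d F -> Q_homog d G -> Q_homog d (a *: F + G).
Proof. exact: mhom_homogP. Qed.

Lemma Q_sumE (I : Type) (r : seq I) (c : I -> Q) :
  Q_mhom (\sum_(i <- r) c i) = \sum_(i <- r) Q_mhom (c i).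
Proof.
elim: r => [|i r ih]; first by rewrite !big_nil.
by rewrite !big_cons -ih.
Qed.

Lemma inQn_homog n f : inQn n f -> mhom_homog n f.
Proof.
move=> [c [hc ->]] s hs; rewrite mhom_sumE big1_seq // => j /andP[_].
rewrite mem_index_iota => /andP[_ /hc[hj _]]; apply: hj.
by rewrite addrA !subrK intS addrC.
Qed.

Lemma Q_gen F : exists r : seq Q,
  (forall G, G \in r -> exists d, Q_homog d G) /\ F = \sum_(G <- r) G.
Proof.
have inQnQ n f : inQn n f -> inQ f.
  move=> hf; apply/asboolP; exists [:: f]; rewrite big_seq1; split=> // g.
  by rewrite inE => /eqP ->; exists n.
have /asboolP[r [hr e]] : inQ F := valP F.
have [t [ht et]] : exists t : seq Q,
    (forall G, G \in t -> exists d, Q_homog d G) /\ [seq Q_mhom G | G <- t] = r.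
  elim: r hr {e} => [|f r ih] hr; first by exists [::].
  have [n hn] := hr f (mem_head f r).
  have [|t [ht et]] := ih; first by move=> g hg; apply: hr; rewrite inE hg orbT.
  exists (MkQ (inQnQ _ _ hn) :: t); rewrite /= et; split=> // G.
  rewrite inE => /predU1P[->|/ht //]; exists n%:Z; exact: inQn_homog hn.
by exists t; split=> //; apply: val_inj; rewrite /= Q_sumE e -et big_map.
Qed.

Lemma Q_indep (ds : seq int) (c : int -> Q) : uniq ds ->
  (forall d, Q_homog d (c d)) -> \sum_(d <- ds) c d = 0 ->
  forall d, d \in ds -> c d = 0.
Proof.
move=> uds hc s0 d dds; apply: val_inj => /=.
apply: (mhom_indep (c := fun e => Q_mhom (c e)) uds) => //.
by rewrite -Q_sumE s0.
Qed.

Definition Q_grading : grading Q := Grading Q_homog0 Q_homogP Q_gen Q_indep.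

(* The graded vector space Q[1] (+) a; the element (F[1], f) is the pair
   (F, f). *)
Definition Qa : lmodType K := (Q * mhom A B)%type.

Definition Qa_grading : grading Qa := dsum (shift Q_grading) (mhom_grading A B).

End AB.

(* x_1 ... x_N = koszul d s *: x_{s 1} ... x_{s N} in the free graded
   commutative algebra, where x_i has degree d i. *)
Definition koszul (K : fieldType) (N : nat) (d : 'I_N -> int) (s : 'S_N) : K :=
  \prod_(i < N) \prod_(j < N | (i < j)%N && (s j < s i)%N)
    (-1) ^ (d (s i) * d (s j)).

Definition shuffle (N i : nat) (s : 'S_N) : bool :=
  [forall a : 'I_N, forall b : 'I_N,
     (a < b)%N && ((b < i)%N || (i <= a)%N) ==> (s a < s b)%N].

(* The brackets l_k, k >= 1, are the restrictions of [l] to words of length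
   k; the value of [l] on the empty word plays no role. *)
Record Linfty_algebra (K : fieldType) (V : lmodType K) (gr : grading V)
    (l : seq V -> V) : Prop := {
  Linfty_multilinear : multilinear l;
  Linfty_degree : forall (N : nat) (d : 'I_N -> int) (x : 'I_N -> V),
    (0 < N)%N -> (forall i, gr (d i) (x i)) ->
    gr (\sum_i d i + 1) (l [seq x i | i : 'I_N]);
  Linfty_symmetric : forall (N : nat) (d : 'I_N -> int) (x : 'I_N -> V),
    (0 < N)%N -> (forall i, gr (d i) (x i)) -> forall s : 'S_N,
    l [seq x i | i : 'I_N] = koszul K d s *: l [seq x (s i) | i : 'I_N];
  Linfty_jacobi : forall (N : nat) (d : 'I_N -> int) (x : 'I_N -> V),
    (0 < N)%N -> (forall i, gr (d i) (x i)) ->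
    \sum_(1 <= i < N.+1) \sum_(s : 'S_N | shuffle i s)
      koszul K d s *: (let y := [seq x (s j) | j : 'I_N] in
                       l (l (take i y) :: drop i y)) = 0 }.

(* Main.v *)
Require Import Defs.
From HB Require Import structures.
From mathcomp Require Import all_boot all_order all_algebra all_fingroup.
From mathcomp Require Import boolp functions.
From mathcomp Require Import ring zify.
Import GRing.Theory.
Local Open Scope ring_scope.

Set Implicit Arguments.
Unset Strict Implicit.
Unset Printing Implicit Defensive.

(** The proof is Voronov's derived bracket construction, applied to the graded
    Lie algebra Q, its abelian subalgebra a and the projection P of Q onto a.

    The maps l_k form a single function on words in Q[1] (+) a.  Each position
    of a word contributes, up to sign, P of the iterated bracket of its
    Q-component with the a-components of all the other entries, and a word of
    length 2 has in addition, up to sign, the bracket of its two Q-components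
    ([derived_bracket]).  Graded symmetry holds because bracketings with
    elements of a commute up to sign, a being abelian ([nested_sum_swap]).

    In the Jacobi identity the sum over shuffles is rewritten as a recursive
    sum over the decompositions of a word into two subwords ([shuffle_sum]).
    It is additive in each entry and graded symmetric, so each entry may be
    taken in Q or in a, those in Q first.  Unless there are exactly two entries
    in Q, or three entries in Q and none in a, every term vanishes
    ([jacobi_term_eq0]).  For three entries in Q the identity is the Jacobi
    identity of Q.  For F, G in Q and f_1, ..., f_n in a it is the formula
    ([P_nest_br])

      P[...[[F, G], f_1], ..., f_n]
        = sum over S, T of  +- P[...[F, P[...[G, f_S]...]], f_T...]
                            +- P[...[G, P[...[F, f_S]...]], f_T...],

    where f_S and f_T run over the complementary subwords of f_1 ... f_n.  It
    follows by induction on n from the derivation property of the bracketing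
    with f_i, from [a, a] = 0 and from P[X, Y] = P[X, P Y] + P[P X, Y].

    It remains to check these properties for Q.  The graded Jacobi identity of
    the Gerstenhaber bracket reduces to the fact that two maps inserted side
    by side into a third one can be inserted in either order, up to sign
    ([insertion_comm]).  A map belongs to Q if and only if it sends words in B
    into B ([inQ_Bclosed], [Bclosed_inQ]); hence Q is stable under the bracket
    and contains a. *)

(** * Equations between linear combinations *)

Section LinearExpressions.
Context (K : fieldType) (V : lmodType K).

(** Formal linear combinations over K; [LVar n] stands for the [n]-th entry of
    an environment. *)
Inductive lexp :=
  LVar of nat | LZero | LAdd of lexp & lexp | LOpp of lexp | LScale of K & lexp.

Fixpoint leval (env : seq V) (e : lexp) : V :=
  match e with
  | LVar n => nth 0 env n
  | LZero => 0
  | LAdd e1 e2 => leval env e1 + leval env e2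
  | LOpp e1 => - leval env e1
  | LScale c e1 => c *: leval env e1
  end.

Fixpoint lcoef (e : lexp) (n : nat) : K :=
  match e with
  | LVar m => if m == n then 1 else 0
  | LZero => 0
  | LAdd e1 e2 => lcoef e1 n + lcoef e2 n
  | LOpp e1 => - lcoef e1 n
  | LScale c e1 => c * lcoef e1 n
  end.

Lemma leval_coef env e :
  leval env e = \sum_(i < size env) lcoef e i *: nth 0 env i.
Proof.
elim: e => [m||e1 h1 e2 h2|e1 h1|c e1 h1] /=.
- have [hm|hm] := ltnP m (size env).
    rewrite (bigD1 (Ordinal hm)) //= eqxx scale1r big1 ?addr0 // => i.
    by rewrite -val_eqE /= eq_sym => /negbTE ->; rewrite scale0r.
  rewrite nth_default // big1 // => i _; case: eqP => [e|]; last by rewrite scale0r.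
  by have := ltn_ord i; rewrite -e ltnNge hm.
- by rewrite big1 // => i _; rewrite scale0r.
- by rewrite h1 h2 -big_split; apply: eq_bigr => i _; rewrite scalerDl.
- by rewrite h1 -sumrN; apply: eq_bigr => i _; rewrite scaleNr.
- by rewrite h1 scaler_sumr; apply: eq_bigr => i _; rewrite scalerA.
Qed.

(** Equality of the coefficients of the variables of index less than [n]. *)
Fixpoint coefs_eq (n : nat) (e1 e2 : lexp) : Prop :=
  if n is m.+1 then lcoef e1 m = lcoef e2 m /\ coefs_eq m e1 e2 else True.

Lemma leval_eq env e1 e2 :
  coefs_eq (size env) e1 e2 -> leval env e1 = leval env e2.
Proof.
move=> h; rewrite !leval_coef; apply: eq_bigr => -[i hi] _ /=; congr (_ *: _).
by elim: (size env) h hi => //= n ih [e h];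
  rewrite ltnS leq_eqVlt => /predU1P[->|/ih->].
Qed.

End LinearExpressions.

(** Index of [x] in the list [env]: a syntactic occurrence is preferred to one
    up to conversion. *)
Ltac lin_idx x env :=
  match env with
  | cons x _ => constr:(O)
  | cons _ ?t => let n := lin_idx x t in constr:(S n)
  | cons ?y _ => let e := constr:(erefl : x = y) in constr:(O)
  end.

(** [env] extended with the atoms of the linear combination [t]. *)
Ltac lin_env t env :=
  lazymatch t with
  | 0 => env
  | (?a + ?b)%R => let env1 := lin_env a env in lin_env b env1
  | (- ?a)%R => lin_env a env
  | (_ *: ?a)%R => lin_env a env
  | _ => match env with
         | _ => let n := lin_idx t env in env
         | _ => constr:(cons t env)
         end
  end.

(** The formal linear combination that evaluates to [t] in [env]. *)
Ltac lin_quote K t env :=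
  lazymatch t with
  | 0 => constr:(LZero K)
  | (?a + ?b)%R => let x := lin_quote K a env in let y := lin_quote K b env in
                 constr:(LAdd x y)
  | (- ?a)%R => let x := lin_quote K a env in constr:(LOpp x)
  | (?c *: ?a)%R => let x := lin_quote K a env in constr:(LScale c x)
  | _ => let n := lin_idx t env in constr:(@LVar K n)
  end.

(** Proves an equation between linear combinations in a K-module by comparing
    coefficients with [ring]. *)
Ltac linear_eq K :=
  lazymatch goal with
  | |- @eq ?T ?a ?b =>
    let env0 := lin_env a (@nil T) in
    let env := lin_env b env0 in
    let x := lin_quote K a env in
    let y := lin_quote K b env in
    apply: (@leval_eq K _ env x y); rewrite /=; repeat split; try ring
  end.

(** * Linear maps and signs *)

Section LinearMaps.
Context (K : fieldType) (U V : lmodType K).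

Lemma linear_zero (phi : U -> V) :
  (forall a x y, phi (a *: x + y) = a *: phi x + phi y) -> phi 0 = 0.
Proof.
by move=> h; have := h (-1) 0 0; rewrite scaler0 addr0 scaleN1r addNr.
Qed.

Lemma linear_scale (phi : U -> V) a x :
  (forall a x y, phi (a *: x + y) = a *: phi x + phi y) ->
  phi (a *: x) = a *: phi x.
Proof.
by move=> h; have := h a x 0; rewrite !addr0 (linear_zero h) addr0.
Qed.

Lemma linear_add (phi : U -> V) x y :
  (forall a x y, phi (a *: x + y) = a *: phi x + phi y) ->
  phi (x + y) = phi x + phi y.
Proof. by move=> h; have := h 1 x y; rewrite !scale1r. Qed.

End LinearMaps.

Section Signs.
Context (K : fieldType).

(** The sign of an integer degree. *)
Definition sgn (d : int) : K := (-1) ^ d.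

Lemma sgnD m n : sgn (m + n) = sgn m * sgn n.
Proof. by rewrite /sgn expfzDr // oppr_eq0 oner_eq0. Qed.

Lemma sgnP m : sgn m = 1 \/ sgn m = -1.
Proof.
case: m => n; rewrite /sgn /exprz /=.
  by rewrite -signr_odd; case: odd; [right|left].
by rewrite -signr_odd; case: odd; [right|left]; rewrite ?expr1 ?invrN invr1.
Qed.

Lemma sgn0 : sgn 0 = 1. Proof. by []. Qed.

Lemma sgn1 : sgn 1 = -1. Proof. by []. Qed.

Lemma sgnn m : sgn m * sgn m = 1.
Proof. by case: (sgnP m) => ->; ring. Qed.

Lemma sgn_nat (n : nat) : sgn n = (-1) ^+ n. Proof. by []. Qed.

End Signs.

(** * Sums over unshuffles *)

(** A property of words that is preserved by swapping adjacent letters is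
    invariant under permutation. *)
Lemma perm_eq_swap (E : eqType) (Q : seq E -> Prop) :
  (forall u a b v, Q (u ++ a :: b :: v) -> Q (u ++ b :: a :: v)) ->
  forall r r', perm_eq r r' -> Q r -> Q r'.
Proof.
move=> swap r r' h.
have back u p a v : Q (p ++ a :: u ++ v) -> Q (p ++ u ++ a :: v).
  elim: u p => //= b u ih p /swap hb; rewrite -cat_rcons.
  by apply: ih; rewrite cat_rcons.
suff H p : Q (p ++ r) -> Q (p ++ r') by exact: (H [::]).
elim: r r' h p => [|a r ih] r' h p.
  by move: h; rewrite perm_sym => /perm_nilP ->.
have ar : a \in r' by rewrite -(perm_mem h) mem_head.
case/splitPr: ar h => u v.
rewrite perm_sym -cat1s perm_catCA /= perm_cons perm_sym => h hQ.
by apply: back; rewrite -cat_rcons; apply: ih => //; rewrite cat_rcons.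
Qed.

Section Unshuffle.
Context (K : fieldType).

(** The total degree of a word whose letters carry their degree. *)
Definition word_degree (E : Type) (r : seq (int * E)) : int := \sum_(p <- r) p.1.

Lemma word_degree_cons (E : Type) (p : int * E) r :
  word_degree (p :: r) = p.1 + word_degree r.
Proof. exact: big_cons. Qed.

Lemma word_degree_cat (E : Type) (r t : seq (int * E)) :
  word_degree (r ++ t) = word_degree r + word_degree t.
Proof. exact: big_cat. Qed.

(** The sum of [g S T], with Koszul sign, over all decompositions of [r] into
    two complementary subwords [S] and [T]: the first letter [x] goes either to
    [S], or to [T], in which case it has to pass the letters of [S]. *)
Fixpoint unshuffle_sum (E : Type) (W : lmodType K)
    (g : seq (int * E) -> seq (int * E) -> W) (r : seq (int * E)) : W :=
  if r is x :: r' then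
    unshuffle_sum (fun S T => g (x :: S) T) r' +
    unshuffle_sum (fun S T => sgn K (x.1 * word_degree S) *: g S (x :: T)) r'
  else g [::] [::].

Section Theory.
Context (E : eqType) (W : lmodType K).
Implicit Types (g : seq (int * E) -> seq (int * E) -> W) (r : seq (int * E)).

Lemma unshuffle_sum_ext g g' r :
  (forall S T, perm_eq (S ++ T) r -> g S T = g' S T) -> unshuffle_sum g r =
    unshuffle_sum g' r.
Proof.
elim: r g g' => /= [|x r ih] g g' e; first exact: e.
congr (_ + _); apply: ih => S T h; rewrite e ?perm_cons //.
by rewrite perm_catC /= perm_cons perm_catC.
Qed.

Lemma unshuffle_sumP a g g' r :
  unshuffle_sum (fun S T => a *: g S T + g' S T) r =
    a *: unshuffle_sum g r + unshuffle_sum g' r.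
Proof.
elim: r g g' => //= x r ih g g'.
rewrite ih [X in _ + X = _](@unshuffle_sum_ext _ (fun S T =>
  a *: (sgn K (x.1 * word_degree S) *: g S (x :: T)) +
  sgn K (x.1 * word_degree S) *: g' S (x :: T))) ?ih => [|S T _]; linear_eq K.
Qed.

Lemma unshuffle_sum0 r : unshuffle_sum (fun _ _ => 0 : W) r = 0.
Proof.
have := @unshuffle_sumP (-1) (fun _ _ => 0) (fun _ _ => 0) r.
by under unshuffle_sum_ext => S T _ do rewrite scaler0 addr0; rewrite scaleN1r addNr.
Qed.

Lemma unshuffle_sum_eq0 g r :
  (forall S T, perm_eq (S ++ T) r -> g S T = 0) -> unshuffle_sum g r = 0.
Proof. by move=> h; rewrite (unshuffle_sum_ext h) unshuffle_sum0. Qed.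

Lemma unshuffle_sumZ a g r :
  unshuffle_sum (fun S T => a *: g S T) r = a *: unshuffle_sum g r.
Proof.
rewrite -[RHS]addr0 -(unshuffle_sum0 r) -unshuffle_sumP.
by apply: unshuffle_sum_ext => S T _; rewrite addr0.
Qed.

Lemma unshuffle_sumD g g' r :
  unshuffle_sum (fun S T => g S T + g' S T) r =
  unshuffle_sum g r + unshuffle_sum g' r.
Proof.
rewrite -[unshuffle_sum g r]scale1r -unshuffle_sumP.
by apply: unshuffle_sum_ext => S T _; rewrite scale1r.
Qed.

(** Only the decomposition with [S] empty counts. *)
Lemma unshuffle_sum_nil (g : seq (int * E) -> W) r :
  unshuffle_sum (fun S T => if S is [::] then g T else 0) r = g r.
Proof.
elim: r g => //= x r ih g; rewrite unshuffle_sum0 add0r -(ih (fun T => g (x :: T))).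
apply: unshuffle_sum_ext => -[|y S] T _; last by rewrite scaler0.
by rewrite /word_degree big_nil mulr0 scale1r.
Qed.

(** If [g] is graded symmetric in each of its two words, then the sum is graded
    symmetric. *)
Lemma unshuffle_sum_swap g u a b v :
  (forall S S' T, perm_eq ((S ++ a :: b :: S') ++ T) (u ++ a :: b :: v) ->
    g (S ++ a :: b :: S') T = sgn K (a.1 * b.1) *: g (S ++ b :: a :: S') T) ->
  (forall S T T', perm_eq (S ++ T ++ a :: b :: T') (u ++ a :: b :: v) ->
    g S (T ++ a :: b :: T') = sgn K (a.1 * b.1) *: g S (T ++ b :: a :: T')) ->
  unshuffle_sum g (u ++ a :: b :: v) =
    sgn K (a.1 * b.1) *: unshuffle_sum g (u ++ b :: a :: v).
Proof.
elim: u g => [|x u ih] g gl gr /=.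
  set s := sgn K _; have ss : s * s = 1 by exact: sgnn.
  have swapD (x1 x2 x3 x4 y1 y2 y3 y4 : W) : x1 = s *: y1 -> x2 = s *: y3 ->
      x3 = s *: y2 -> x4 = s *: y4 -> x1 + x2 + (x3 + x4) =
        s *: (y1 + y2 + (y3 + y4)).
    by move=> -> -> -> ->; linear_eq K.
  (* the two letters are both in S, one in each word (twice), or both in T *)
  apply: swapD; rewrite -unshuffle_sumZ; apply: unshuffle_sum_ext => S T h.
  - by rewrite (gl [::]) ?perm_cons.
  - rewrite !word_degree_cons !mulrDr !sgnD (mulrC b.1 a.1) -/s !scalerA !mulrA ss.
    by rewrite mul1r.
  - by rewrite !word_degree_cons !mulrDr !sgnD -/s scalerA.
  - rewrite (gr _ [::]) /= -/s; last by rewrite perm_catC /= !perm_cons perm_catC.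
    linear_eq K.
rewrite !ih ?scalerDr //.
- move=> S S' T h; rewrite !word_degree_cat !word_degree_cons gl; last first.
    by rewrite perm_catC /= perm_cons perm_catC.
  rewrite (addrCA a.1); linear_eq K.
- move=> S T T' h; rewrite (gr S (x :: T)); last first.
    by rewrite perm_catC /= perm_cons perm_catC.
  rewrite /=; linear_eq K.
- by move=> S S' T h; rewrite (gl (x :: S)) //= perm_cons.
- by move=> S T T' h; rewrite gr //= perm_cons.
Qed.

Lemma unshuffle_sum_map (E' : Type) (f : int * E' -> int * E)
    g (r : seq (int * E')) : (forall p, (f p).1 = p.1) ->
  unshuffle_sum g [seq f p | p <- r] =
    unshuffle_sum (fun S T => g [seq f p | p <- S] [seq f p | p <- T]) r.
Proof.
move=> f1; elim: r g => //= x r ih g; rewrite !ih f1.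
congr (_ + _).
have e (S : seq (int * E')) : word_degree [seq f p | p <- S] = word_degree S.
  by rewrite /word_degree big_map; apply: eq_bigr => p _; rewrite f1.
suff -> : (fun S T => sgn K (x.1 * word_degree [seq f p | p <- S]) *:
   g [seq f p | p <- S] (f x :: [seq f p | p <- T])) =
   (fun S T => sgn K (x.1 * word_degree S) *:
   g [seq f p | p <- S] (f x :: [seq f p | p <- T])) by [].
by apply/funext => S; apply/funext => T; rewrite e.
Qed.

Lemma unshuffle_sum_linear (W' : lmodType K) (phi : W -> W') g r :
  (forall a x y, phi (a *: x + y) = a *: phi x + phi y) ->
  unshuffle_sum (fun S T => phi (g S T)) r = phi (unshuffle_sum g r).
Proof.
move=> lin; elim: r g => //= x r ih g; rewrite (linear_add _ _ lin) -!ih.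
congr (_ + unshuffle_sum _ r).
by apply/funext => S; apply/funext => T; rewrite (linear_scale _ _ lin).
Qed.

End Theory.

Lemma unshuffle_sum_add (E W : lmodType K)
    (g : seq (int * E) -> seq (int * E) -> W) d (x y : E) u t :
  (forall S S' T, g (S ++ (d, x + y) :: S') T =
     g (S ++ (d, x) :: S') T + g (S ++ (d, y) :: S') T) ->
  (forall S T T', g S (T ++ (d, x + y) :: T') =
     g S (T ++ (d, x) :: T') + g S (T ++ (d, y) :: T')) ->
  unshuffle_sum g (u ++ (d, x + y) :: t) =
  unshuffle_sum g (u ++ (d, x) :: t) + unshuffle_sum g (u ++ (d, y) :: t).
Proof.
elim: u g => [|z u ih] g gl gr /=.
  rewrite addrACA; congr (_ + _); rewrite -unshuffle_sumD;
    apply: unshuffle_sum_ext => S T _.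
    exact: (gl [::]).
  by rewrite (gr _ [::]) scalerDr.
rewrite !ih 1?addrACA //.
- by move=> S S' T; rewrite !word_degree_cat !word_degree_cons gl scalerDr.
- by move=> S T T'; rewrite (gr S (z :: T)) scalerDr.
- by move=> S S' T; exact: (gl (z :: S)).
Qed.

End Unshuffle.

(** * Shuffles as decompositions of words *)

Section Splits.
Context (T : eqType).
Implicit Types (r S R : seq T).

(** The decompositions of [r] into two complementary subwords. *)
Fixpoint splits r : seq (seq T * seq T) :=
  if r is x :: r' then
    [seq (x :: p.1, p.2) | p <- splits r'] ++
    [seq (p.1, x :: p.2) | p <- splits r']
  else [:: ([::], [::])].

Lemma perm_cat_cons a S R r : perm_eq (S ++ a :: R) (a :: r) = perm_eq (S ++ R) r.
Proof. by rewrite perm_catC /= perm_cons perm_catC. Qed.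

Lemma splits_perm r p : p \in splits r -> perm_eq (p.1 ++ p.2) r.
Proof.
elim: r p => [|a r ih] p /=; first by rewrite inE => /eqP ->.
rewrite mem_cat => /orP[] /mapP[q /ih hq ->] /=; first by rewrite perm_cons.
by rewrite perm_cat_cons.
Qed.

Lemma splits_uniq r : uniq r -> uniq (splits r).
Proof.
elim: r => //= a r ih /andP[ar /ih hr]; rewrite cat_uniq !map_inj_uniq ?hr.
- rewrite /= andbT; apply/hasPn => _ /mapP[q hq ->]; apply/mapP => -[p hp [e _]].
  by move: ar; rewrite -(perm_mem (splits_perm hq)) mem_cat e mem_head.
- by move=> [S R] [S' R'] /= [-> ->].
- by move=> [S R] [S' R'] /= [-> ->].
Qed.

Context (lt : rel T) (lt_trans : transitive lt) (lt_irr : irreflexive lt).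

(** The subwords of a sorted word are sorted, and the decompositions are exactly
    the pairs of sorted words that rearrange [r]. *)
Lemma mem_splits r S R : sorted lt r ->
  ((S, R) \in splits r) = [&& perm_eq (S ++ R) r, sorted lt S & sorted lt R].
Proof.
have pmin a s : path lt a s = all (lt a) s && sorted lt s.
  exact: (path_sortedE lt_trans).
elim: r S R => [|a r ih] S R.
  move=> _; rewrite inE; apply/eqP/and3P => [[-> ->]//|[/perm_nilP]].
  by case: S R => [|x S] [|y R].
rewrite /= pmin => /andP[/allP amin hr]; rewrite mem_cat; apply/orP/and3P.
  case=> /mapP[[S' R']] h [-> ->]; move: (h); rewrite ih // => /and3P[hp hS hR];
    have hm x : x \in S' ++ R' -> lt a x by rewrite (perm_mem hp); exact: amin.
  - split=> //; first by rewrite perm_cons.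
    by rewrite /= pmin hS andbT; apply/allP => x hx; apply: hm; rewrite mem_cat hx.
  - split=> //; first by rewrite perm_cat_cons.
    rewrite /= pmin hR andbT; apply/allP => x hx; apply: hm.
    by rewrite mem_cat hx orbT.
case=> hp hS hR.
have am : a \in S ++ R by rewrite (perm_mem hp) mem_head.
have low x : x \in S ++ R -> lt x a = false.
  rewrite (perm_mem hp) inE => /predU1P[->|/amin ax]; first exact: lt_irr.
  by apply/negP => xa; have := lt_irr a; rewrite (lt_trans ax xa).
move: am; rewrite mem_cat => /orP[] am; [left|right].
  case: S am hp hS low => // x S; rewrite inE => am hp hS low.
  have ex : x = a.
    case/predU1P: am => [//|am]; have := low x (mem_head _ _).
    by move: hS; rewrite /= pmin => /andP[/allP/(_ _ am) ->].
  subst x; move: hp hS; rewrite /= perm_cons pmin => hp /andP[_ hS].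
  by apply/mapP; exists (S, R) => //; rewrite ih // hp hS.
case: R am hp hR low => // x R; rewrite inE => am hp hR low.
have ex : x = a.
  case/predU1P: am => [//|am]; have := low x; rewrite mem_cat mem_head orbT.
  by move: hR; rewrite /= pmin => /andP[/allP/(_ _ am) ->] _ /(_ isT).
subst x; move: hp hR; rewrite perm_cat_cons /= pmin => hp /andP[_ hR].
by apply/mapP; exists (S, R) => //; rewrite ih // hp hS.
Qed.

End Splits.

Section Koszul.
Context (K : fieldType) (N : nat) (d : 'I_N -> int).
Implicit Types (r S R : seq 'I_N).

Definition lt_ord : rel 'I_N := fun i j => (i < j)%N.

Lemma lt_ord_trans : transitive lt_ord. Proof. by move=> j i k; exact: ltn_trans. Qed.
Lemma lt_ord_irr : irreflexive lt_ord. Proof. by move=> i; exact: ltnn. Qed.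

Lemma sorted_enum_ord : sorted lt_ord (enum 'I_N).
Proof.
by have := iota_ltn_sorted 0 N; rewrite -val_enum_ord sorted_map.
Qed.

(** The Koszul sign that sorts the word [r] of indices, where the index [i] has
    degree [d i]. *)
Fixpoint word_sign r : K :=
  if r is a :: r' then
    (\prod_(b <- r') if (b < a)%N then sgn K (d a * d b) else 1) * word_sign r'
  else 1.

(** The word s(0) ... s(N-1) of a permutation. *)
Definition perm_word (s : 'S_N) : seq 'I_N := [seq s i | i : 'I_N].

Lemma size_perm_word s : size (perm_word s) = N.
Proof. by rewrite size_map size_enum_ord. Qed.

Lemma nth_perm_word x0 s (i : 'I_N) : nth x0 (perm_word s) i = s i.
Proof. by rewrite (nth_map i) ?size_enum_ord // nth_ord_enum. Qed.

Lemma koszul_word_sign s : koszul K d s = word_sign (perm_word s).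
Proof.
have wsE x0 r : word_sign r = \prod_(0 <= i < size r) \prod_(0 <= j < size r)
    if (i < j)%N && (nth x0 r j < nth x0 r i)%N
    then sgn K (d (nth x0 r i) * d (nth x0 r j)) else 1.
  elim: r => [|a r ih] /=; first by rewrite big_nil.
  rewrite big_nat_recl // big_nat_recl //= mul1r (big_nth x0); congr (_ * _).
  rewrite ih; apply: eq_bigr => i _; rewrite big_nat_recl //= mul1r.
  by apply: eq_bigr => j _; rewrite ltnS.
case: (posnP N) => [N0|Npos].
  rewrite /koszul big1 => [|i _]; last by have := ltn_ord i; rewrite {2}N0.
  by rewrite (_ : perm_word s = [::]) //; apply: size0nil; rewrite size_perm_word.
pose x0 := Ordinal Npos; rewrite (wsE x0) size_perm_word big_mkord.
apply: eq_bigr => i _; rewrite big_mkord big_mkcond; apply: eq_bigr => j _.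
by rewrite !nth_perm_word.
Qed.

Lemma word_sign_sorted r : sorted lt_ord r -> word_sign r = 1.
Proof.
elim: r => //= a r ih; rewrite (path_sortedE lt_ord_trans) => /andP[/allP h /ih ->].
rewrite mulr1 big1_seq // => b /andP[_ /h]; rewrite /lt_ord => ab.
by rewrite ltnNge (ltnW ab).
Qed.

Lemma word_sign_swap u a b v : a != b ->
  word_sign (u ++ a :: b :: v) = sgn K (d a * d b) * word_sign (u ++ b :: a :: v).
Proof.
move=> ab; elim: u => [|c u ih] /=.
  rewrite !big_cons (mulrC (d b)); set s := sgn K _.
  have ss : s * s = 1 by exact: sgnn.
  have [h|h|/val_inj e] := ltngtP a b; last by rewrite e eqxx in ab.
    by rewrite !mul1r -!mulrA (mulrA s s) ss mul1r; ring.
  by rewrite !mul1r; ring.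
rewrite ih (perm_big (u ++ b :: a :: v)) /=; first by rewrite mulrCA.
by rewrite perm_cat2l -(cat1s b) -(cat1s a) perm_catCA.
Qed.

Lemma word_sign_front (E : Type) (x : 'I_N -> E) S R (a : 'I_N) :
  (forall b : 'I_N, b \in S ++ R -> (a < b)%N) ->
  word_sign (S ++ a :: R) =
    sgn K (d a * word_degree [seq (d i, x i) | i <- S]) * word_sign (S ++ R).
Proof.
elim: S => [|b S ih] h /=.
  rewrite /word_degree big_nil mulr0 mul1r big1_seq ?mul1r // => b /andP[_ hb].
  by rewrite ltnNge ltnW // h.
have ab : (a < b)%N by apply: h; rewrite mem_head.
rewrite ih; last by move=> c hc; apply: h; rewrite inE hc orbT.
rewrite big_cat big_cons ab /= [in RHS]big_cat /= word_degree_cons /= mulrDr sgnD.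
rewrite (mulrC (d b)); ring.
Qed.

Lemma unshuffle_sum_splits (E : eqType) (x : 'I_N -> E) (W : lmodType K)
    (g : seq (int * E) -> seq (int * E) -> W) r : sorted lt_ord r ->
  unshuffle_sum g [seq (d i, x i) | i <- r] =
  \sum_(p <- splits r) word_sign (p.1 ++ p.2) *:
     g [seq (d i, x i) | i <- p.1] [seq (d i, x i) | i <- p.2].
Proof.
elim: r g => [|a r ih] g; first by rewrite big_seq1 /= scale1r.
rewrite /= (path_sortedE lt_ord_trans) => /andP[/allP amin hr].
rewrite !ih // big_cat !big_map; congr (_ + _); apply: eq_big_seq => p hp /=;
  have hm (b : 'I_N) : b \in p.1 ++ p.2 -> (a < b)%N
    by rewrite (perm_mem (splits_perm hp)); exact: amin.
  rewrite big1_seq ?mul1r // => b /andP[_ /hm ab].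
  by rewrite ltnNge (ltnW ab).
by rewrite (word_sign_front x hm) scalerA mulrC.
Qed.

Lemma perm_perm_word s : perm_eq (perm_word s) (enum 'I_N).
Proof.
apply: uniq_perm; last 1 first.
- move=> i; rewrite mem_enum; apply/mapP.
  by exists ((s^-1)%g i); rewrite ?mem_enum // permKV.
- by rewrite map_inj_uniq ?enum_uniq //; exact: perm_inj.
- exact: enum_uniq.
Qed.

Lemma perm_word_inj : injective perm_word.
Proof.
move=> s t e; apply/permP => i.
by rewrite -(nth_perm_word i s i) e nth_perm_word.
Qed.

Lemma perm_word_surj r : perm_eq r (enum 'I_N) -> exists s, perm_word s = r.
Proof.
move=> h; have sz : size r = N by rewrite (perm_size h) size_enum_ord.
have ur : uniq r by rewrite (perm_uniq h) enum_uniq.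
have inj : injective (fun i : 'I_N => nth i r i).
  move=> i j; rewrite (set_nth_default j) ?sz // => /eqP.
  by rewrite nth_uniq ?sz // => /eqP/val_inj.
exists (perm inj); case: (posnP N) => [N0|Npos].
  have nil_of (q : seq 'I_N) : size q = N -> q = [::].
    by move=> e; apply: size0nil; rewrite e.
  by rewrite (nil_of _ (size_perm_word _)); apply/esym; exact: nil_of.
apply: (@eq_from_nth _ (Ordinal Npos)); rewrite size_perm_word // => k hk.
rewrite (nth_perm_word _ _ (Ordinal hk)) permE.
by apply: set_nth_default; rewrite sz.
Qed.

Lemma shuffle_sorted (i : nat) s :
  shuffle i s =
    sorted lt_ord (take i (perm_word s)) && sorted lt_ord (drop i (perm_word s)).
Proof.
have sl := size_perm_word s.
apply/idP/andP => [/forallP h|[h1 h2]].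
  have {}h (a b : 'I_N) : (a < b)%N -> (b < i)%N || (i <= a)%N -> (s a < s b)%N.
    by move=> ab hb; have /forallP/(_ b) := h a; rewrite ab hb.
  case: (posnP N) => [N0|Npos].
    by rewrite (_ : perm_word s = [::]) //; apply: size0nil; rewrite sl.
  pose x0 := Ordinal Npos; split; apply/(sortedP x0) => k.
    rewrite size_take sl => hk.
    have hi : (k.+1 < i)%N by move: hk; case: ifP => //; lia.
    have hN : (k.+1 < N)%N by move: hk; case: ifP => //; lia.
    rewrite !nth_take ?(ltnW hi) //.
    rewrite (nth_perm_word _ _ (Ordinal hN)) (nth_perm_word _ _ (Ordinal (ltnW hN))).
    by apply: h => //=; rewrite hi.
  rewrite size_drop sl => hk.
  have hN : (i + k.+1 < N)%N by lia.
  have hN' : (i + k < N)%N by lia.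
  rewrite !nth_drop (nth_perm_word _ _ (Ordinal hN)) (nth_perm_word _ _ (Ordinal hN')).
  by apply: h => /=; lia.
apply/forallP => a; apply/forallP => b; apply/implyP => /andP[ab].
have := ltn_ord a; have := ltn_ord b => hb ha.
rewrite -(nth_perm_word a s a) -(nth_perm_word a s b) => /orP[bi|ia].
  have := sorted_ltn_nth lt_ord_trans a h1; move=> /(_ a b).
  rewrite !inE size_take sl !nth_take ?(ltn_trans ab bi) //.
  by apply=> //; case: ifP; lia.
have := sorted_ltn_nth lt_ord_trans a h2; move=> /(_ (a - i)%N (b - i)%N).
rewrite !inE size_drop sl !nth_drop !subnKC //; last by lia.
by apply; lia.
Qed.

(** A shuffle amounts to a decomposition of the word 0 ... N-1 into two
    subwords. *)
Lemma shuffle_sum (E : eqType) (x : 'I_N -> E) (W : lmodType K)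
    (g : seq (int * E) -> seq (int * E) -> W) :
  \sum_(0 <= i < N.+1) \sum_(s : 'S_N | shuffle i s)
    koszul K d s *: g (take i [seq (d j, x j) | j <- perm_word s])
                      (drop i [seq (d j, x j) | j <- perm_word s]) =
  unshuffle_sum g [seq (d i, x i) | i : 'I_N].
Proof.
pose F (p : seq 'I_N * seq 'I_N) := word_sign (p.1 ++ p.2) *:
     g [seq (d i, x i) | i <- p.1] [seq (d i, x i) | i <- p.2].
pose split (i : nat) s := (take i (perm_word s), drop i (perm_word s)).
pose sh (i : nat) := [seq s <- index_enum {perm 'I_N} | shuffle i s].
rewrite (unshuffle_sum_splits _ _ sorted_enum_ord).
transitivity (\sum_(p <- [seq split i s | i <- iota 0 N.+1, s <- sh i]) F p).
  rewrite big_allpairs_dep /index_iota subn0; apply: eq_bigr => i _.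
  rewrite big_filter; apply: eq_bigr => s _.
  by rewrite /F /split /= cat_take_drop map_take map_drop koszul_word_sign.
apply: perm_big; apply: uniq_perm.
- apply: allpairs_uniq_dep; first exact: iota_uniq.
    by move=> i _; rewrite filter_uniq ?index_enum_uniq.
  move=> p q /allpairsPdep[i [s [hi _ ->]]] /allpairsPdep[j [t [hj _ ->]]] /= [e1 e2].
  have es : s = t.
    apply: perm_word_inj.
    by rewrite -(cat_take_drop i (perm_word s)) e1 e2 cat_take_drop.
  have eij : i = j.
    move: hi hj; rewrite !mem_iota !add0n !ltnS => /andP[_ hi] /andP[_ hj].
    by have := congr1 size e1; rewrite !size_takel ?size_perm_word.
  by rewrite es eij.
- by rewrite splits_uniq ?enum_uniq.
move=> [S R]; rewrite (mem_splits lt_ord_trans lt_ord_irr _ _ sorted_enum_ord).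
apply/allpairsPdep/and3P => [[i [s [hi hs [-> ->]]]]|[hp hS hR]].
  move: hs; rewrite mem_filter shuffle_sorted => /andP[/andP[h1 h2] _].
  by rewrite cat_take_drop perm_perm_word.
have [s es] := perm_word_surj hp.
exists (size S), s; rewrite /split mem_filter mem_index_enum andbT shuffle_sorted es.
rewrite take_size_cat // drop_size_cat // hS hR; split=> //.
have := size_perm_word s; rewrite es size_cat mem_iota add0n ltnS /= => eN.
by rewrite -[X in (_ <= X)%N]eN; exact: leq_addr.
Qed.

End Koszul.

(** * Derived brackets *)

(** [L] is a graded Lie algebra with bracket [br], and [e] maps the graded space
    [M] onto an abelian subalgebra of [L].  The operators [sg] and [sgM]
    multiply homogeneous elements by the sign of their degree; they make sense
    of such signs for arbitrary elements.  The last assumption holds when [P] is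
    a left inverse of [e] whose kernel is a subalgebra, and only this
    consequence is needed. *)
Section DerivedBrackets.
Context (K : fieldType) (L M : lmodType K) (gL : grading L) (gM : grading M).
Context (br : L -> L -> L) (sg : L -> L) (sgM : M -> M) (P : L -> M) (e : M -> L).
Context (brPl : forall a X Y Z, br (a *: X + Y) Z = a *: br X Z + br Y Z).
Context (brPr : forall a X Y Z, br Z (a *: X + Y) = a *: br Z X + br Z Y).
Context (sgP : forall a X Y, sg (a *: X + Y) = a *: sg X + sg Y).
Context (sgMP : forall a f g, sgM (a *: f + g) = a *: sgM f + sgM g).
Context (PP : forall a X Y, P (a *: X + Y) = a *: P X + P Y).
Context (eP : forall a f g, e (a *: f + g) = a *: e f + e g).
Context (br_deg : forall m n X Y, gL m X -> gL n Y -> gL (m + n) (br X Y)).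
Context (br_anti : forall m n X Y, gL m X -> gL n Y ->
  br X Y = - (sgn K (m * n) *: br Y X)).
Context (br_jacobi : forall m n p X Y Z, gL m X -> gL n Y -> gL p Z ->
  br (br X Y) Z = br X (br Y Z) + sgn K (n * p) *: br (br X Z) Y).
Context (sg_deg : forall m X, gL m X -> sg X = sgn K m *: X).
Context (sgM_deg : forall m f, gM m f -> sgM f = sgn K m *: f).
Context (P_deg : forall m X, gL m X -> gM m (P X)).
Context (e_deg : forall m f, gM m f -> gL m (e f)).
Context (br_ee : forall f g, br (e f) (e g) = 0).
Context (P_br : forall X Y, P (br X Y) = P (br X (e (P Y))) + P (br (e (P X)) Y)).

Local Notation E := (L * M)%type.
Implicit Types (X Y Z : L) (f g : M) (w : seq E).

Lemma br0l X : br 0 X = 0.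
Proof. exact: (@linear_zero _ _ _ (br^~ X)). Qed.
Lemma br0r X : br X 0 = 0.
Proof. exact: (@linear_zero _ _ _ (br X)). Qed.
Lemma brZl a X Y : br (a *: X) Y = a *: br X Y.
Proof. exact: (@linear_scale _ _ _ (br^~ Y)). Qed.
Lemma brZr a X Y : br X (a *: Y) = a *: br X Y.
Proof. exact: (@linear_scale _ _ _ (br X)). Qed.
Lemma brBr X Y Z : br X (Y - Z) = br X Y - br X Z.
Proof. by rewrite addrC -scaleN1r brPr scaleN1r addrC. Qed.
Lemma e0 : e 0 = 0. Proof. exact: linear_zero. Qed.
Lemma eZ a f : e (a *: f) = a *: e f. Proof. exact: linear_scale. Qed.
Lemma P0 : P 0 = 0. Proof. exact: linear_zero. Qed.
Lemma PZ a X : P (a *: X) = a *: P X. Proof. exact: linear_scale. Qed.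
Lemma PN X : P (- X) = - P X. Proof. by rewrite -scaleN1r PZ scaleN1r. Qed.
Lemma PD X Y : P (X + Y) = P X + P Y. Proof. exact: linear_add. Qed.
Lemma sg0 : sg 0 = 0. Proof. exact: linear_zero. Qed.
Lemma sgM0 : sgM 0 = 0. Proof. exact: linear_zero. Qed.

(** Right bracketings with elements of [M] commute up to sign. *)
Lemma br_ext_comm m a b X f g : gL m X -> gM a f -> gM b g ->
  br (br X (e f)) (e g) = sgn K (a * b) *: br (br X (e g)) (e f).
Proof.
by move=> hX hf hg; rewrite (br_jacobi hX (e_deg hf) (e_deg hg)) br_ee br0r add0r.
Qed.

(** Left and right bracketings with elements of [M] commute. *)
Lemma br_ext_assoc m a b X f g : gL m X -> gM a f -> gM b g ->
  br (e f) (br X (e g)) = br (br (e f) X) (e g).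
Proof.
move=> hX hf hg.
by rewrite (br_jacobi (e_deg hf) hX (e_deg hg)) br_ee br0l scaler0 addr0.
Qed.

Lemma br_ext_left_comm m a b X f g : gL m X -> gM a f -> gM b g ->
  br (e f) (br (e g) X) = sgn K (a * b) *: br (e g) (br (e f) X).
Proof.
move=> hX hf hg.
rewrite (br_anti (e_deg hg) hX) -scaleNr brZr (br_ext_assoc hX hf hg).
rewrite (br_anti (e_deg hg) (br_deg (e_deg hf) hX)).
rewrite mulrDr !sgnD (mulrC b a).
by case: (sgnP K (a * b)) => ->; linear_eq K.
Qed.

(** The iterated bracket [...[[X, f_1], f_2], ..., f_n]. *)
Definition nest X (fs : seq M) : L := foldl (fun Y f => br Y (e f)) X fs.

Lemma nestP a X Y fs : nest (a *: X + Y) fs = a *: nest X fs + nest Y fs.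
Proof. by elim: fs X Y => //= f fs ih X Y; rewrite brPl ih. Qed.

Lemma nest0 fs : nest 0 fs = 0.
Proof. exact: (linear_zero (fun a X Y => nestP a X Y fs)). Qed.

Lemma nestZ a X fs : nest (a *: X) fs = a *: nest X fs.
Proof. exact: (linear_scale a X (fun a X Y => nestP a X Y fs)). Qed.

Lemma nestD X Y fs : nest (X + Y) fs = nest X fs + nest Y fs.
Proof. exact: (linear_add X Y (fun a X Y => nestP a X Y fs)). Qed.

Lemma nest_letterP X fs gs a f g :
  nest X (fs ++ (a *: f + g) :: gs) =
  a *: nest X (fs ++ f :: gs) + nest X (fs ++ g :: gs).
Proof. by rewrite /nest !foldl_cat /= eP brPr -!/(nest _ _) nestP. Qed.

Lemma nest_mem0 X fs : 0 \in fs -> nest X fs = 0.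
Proof.
case/splitPr => p1 p2; rewrite /nest foldl_cat /= e0 br0r; exact: nest0.
Qed.

(** The sum, with Koszul signs, over the positions of [w] of the iterated
    brackets of the L-component at that position with the M-components at all
    the others.  The letters on its left are moved to its right: with f
    of degree d and X of degree m in [L], hence m - 1 in the shifted space,
    passing from f X to X f costs the sign of (m - 1)d and [X, f] is - [f, X]
    times the sign of md, so that f X contributes - [f, X] times the sign of
    d. *)
Fixpoint nested_sum w : L :=
  if w is x :: w' then
    nest x.1 [seq y.2 | y <- w'] - br (e (sgM x.2)) (nested_sum w')
  else 0.

(** The component in [L], which only exists on words of length 2. *)
Definition binary_part w : L := if w is [:: x; y] then br (sg x.1) y.1 else 0.

(** The maps l_k, on words of length k. *)
Definition derived_bracket w : E := (binary_part w, P (nested_sum w)).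

Local Notation l := derived_bracket.

Lemma derived_bracket_multilinear : multilinear l.
Proof.
have D s t a (u v : E) :
    nested_sum (s ++ (a *: u + v) :: t) =
      a *: nested_sum (s ++ u :: t) + nested_sum (s ++ v :: t).
  elim: s => [|x s ih] /=.
    by rewrite nestP sgMP eP brPl; linear_eq K.
  rewrite ih brPr !map_cat /= nest_letterP; linear_eq K.
move=> s t a u v; rewrite /l D PP.
suff -> : binary_part (s ++ (a *: u + v) :: t) =
  a *: binary_part (s ++ u :: t) + binary_part (s ++ v :: t).
  by congr pair.
case: s => [|x [|y s]] /=.
- case: t => [|y [|z t]] /=; rewrite ?sgP ?brPl //; linear_eq K.
- by case: t => [|y t]; rewrite ?brPr //; linear_eq K.
- by case: s => [|z s] /=; linear_eq K.
Qed.

Lemma derived_bracketZ c x w : l (c *: x :: w) = c *: l (x :: w).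
Proof.
exact: (@linear_scale _ _ _ (fun x => l (x :: w)) c x
  (fun a x y => derived_bracket_multilinear [::] w a x y)).
Qed.

Lemma derived_bracketD s w x y :
  l (s ++ (x + y) :: w) = l (s ++ x :: w) + l (s ++ y :: w).
Proof.
exact: (@linear_add _ _ _ (fun x => l (s ++ x :: w)) x y
  (fun a x y => derived_bracket_multilinear s w a x y)).
Qed.

Lemma derived_bracket0 w : l (0 :: w) = 0.
Proof.
exact: (@linear_zero _ _ _ (fun x => l (x :: w))
  (fun a x y => derived_bracket_multilinear [::] w a x y)).
Qed.

Local Notation gE := (dsum (shift gL) gM).
Local Notation T := (int * E)%type.

(** The element has in L[1] (+) M the degree that it is paired with. *)
Definition homog_letter (p : T) := gE p.1 p.2.
Definition homog_word (r : seq T) := forall p, p \in r -> homog_letter p.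
Definition letters (r : seq T) : seq E := [seq p.2 | p <- r].

Lemma homog_word_cons p r : homog_word (p :: r) <-> homog_letter p /\ homog_word r.
Proof.
split=> [h|[h1 h2] q]; last by rewrite inE => /predU1P[->|/h2].
by split=> [|q hq]; apply: h; rewrite inE ?eqxx // hq orbT.
Qed.

Lemma homog_word_cat r t : homog_word (r ++ t) <-> homog_word r /\ homog_word t.
Proof.
split=> [h|[h1 h2] q]; last by rewrite mem_cat => /orP[/h1|/h2].
by split=> q hq; apply: h; rewrite mem_cat hq ?orbT.
Qed.

Lemma homog_word_perm r t : perm_eq r t -> homog_word t -> homog_word r.
Proof. by move=> h ht p; rewrite (perm_mem h); exact: ht. Qed.

Lemma gL_eq m n X : m = n -> gL m X -> gL n X. Proof. by move=> ->. Qed.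
Lemma gL_D m X Y : gL m X -> gL m Y -> gL m (X + Y).
Proof. by move=> hX hY; rewrite -[X]scale1r; apply: homogP. Qed.
Lemma gL_Z m a X : gL m X -> gL m (a *: X).
Proof. by move=> hX; rewrite -[_ *: _]addr0; apply: homogP => //; exact: homog0. Qed.
Lemma gL_N m X : gL m X -> gL m (- X).
Proof. by rewrite -scaleN1r; exact: gL_Z. Qed.
Lemma gM_Z m a f : gM m f -> gM m (a *: f).
Proof. by move=> hX; rewrite -[_ *: _]addr0; apply: homogP => //; exact: homog0. Qed.

(** Words with homogeneous letters in [M]. *)
Definition homog_Mword (r : seq (int * M)) := forall p, p \in r -> gM p.1 p.2.

Lemma homog_Mword_cons p r : homog_Mword (p :: r) <-> gM p.1 p.2 /\ homog_Mword r.
Proof.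
split=> [h|[h1 h2] q]; last by rewrite inE => /predU1P[->|/h2].
by split=> [|q hq]; apply: h; rewrite inE ?eqxx // hq orbT.
Qed.

Lemma nest_deg_Mword m X (r : seq (int * M)) : gL m X -> homog_Mword r ->
  gL (m + word_degree r) (nest X [seq p.2 | p <- r]).
Proof.
elim: r m X => [|p r ih] m X hX /=.
  by move=> _; rewrite /word_degree big_nil addr0.
move=> /homog_Mword_cons[hp hr]; rewrite word_degree_cons addrA.
by apply: ih => //; apply: br_deg => //; exact: e_deg.
Qed.

Lemma br_ext_nest_Mword m a X f (r : seq (int * M)) :
  gL m X -> gM a f -> homog_Mword r ->
  br (e f) (nest X [seq p.2 | p <- r]) = nest (br (e f) X) [seq p.2 | p <- r].
Proof.
elim: r m X => //= p r ih m X hX hf /homog_Mword_cons[hp hr].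
rewrite (ih (m + p.1)) //; last by apply: br_deg => //; exact: e_deg.
by rewrite (br_ext_assoc hX hf hp).
Qed.

Lemma Mletters_eq (r : seq T) :
  [seq y.2 | y <- letters r] = [seq p.2 | p <- [seq (p.1, p.2.2) | p <- r]].
Proof. by rewrite /letters -!map_comp. Qed.

Lemma homog_Mword_of (r : seq T) :
  homog_word r -> homog_Mword [seq (p.1, p.2.2) | p <- r].
Proof. by move=> h p /mapP[q hq ->]; case: (h q hq). Qed.

Lemma nest_deg m X (r : seq T) : gL m X -> homog_word r ->
  gL (m + word_degree r) (nest X [seq y.2 | y <- letters r]).
Proof.
move=> hX hr; rewrite Mletters_eq; have := nest_deg_Mword hX (homog_Mword_of hr).
by rewrite /word_degree big_map.
Qed.

Lemma sgM_homog m f : gM m f -> gM m (sgM f).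
Proof. by move=> h; rewrite (sgM_deg h); exact: gM_Z. Qed.

Lemma nested_sum_deg r :
  homog_word r -> gL (word_degree r + 1) (nested_sum (letters r)).
Proof.
elim: r => [|p r ih] /=; first by move=> _; exact: homog0.
move=> /homog_word_cons[[hp1 hp2] hr]; rewrite word_degree_cons; apply: gL_D.
  by apply: (gL_eq _ (nest_deg hp1 hr)); rewrite addrAC.
apply: gL_N; rewrite -addrA; apply: br_deg; last exact: ih.
by apply: e_deg; exact: sgM_homog.
Qed.

Lemma binary_part_deg r :
  homog_word r -> gL (word_degree r + 1 + 1) (binary_part (letters r)).
Proof.
case: r => [|x [|y [|z r]]] /=; try by move=> _; exact: homog0.
move=> /homog_word_cons[[hx _] /homog_word_cons[[hy _] _]].
rewrite (sg_deg hx) brZl; apply: gL_Z; apply: (gL_eq _ (br_deg hx hy)).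
by rewrite /word_degree !big_cons big_nil; ring.
Qed.

Lemma derived_bracket_deg r : homog_word r -> gE (word_degree r + 1) (l (letters r)).
Proof.
by move=> h; split; [exact: binary_part_deg|apply: P_deg; exact: nested_sum_deg].
Qed.

Lemma br_ext_nest m a X f (r : seq T) : gL m X -> gM a f -> homog_word r ->
  br (e f) (nest X [seq y.2 | y <- letters r]) =
    nest (br (e f) X) [seq y.2 | y <- letters r].
Proof.
by move=> hX hf hr; rewrite Mletters_eq (br_ext_nest_Mword hX hf) //;
  exact: homog_Mword_of.
Qed.

Lemma nest_swap m X u a b v : gL m X -> homog_word (u ++ a :: b :: v) ->
  nest X [seq y.2 | y <- letters (u ++ a :: b :: v)] =
  sgn K (a.1 * b.1) *: nest X [seq y.2 | y <- letters (u ++ b :: a :: v)].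
Proof.
move=> hX /homog_word_cat[hu /homog_word_cons[[_ ha] /homog_word_cons[[_ hb] _]]].
rewrite /letters !map_cat /nest !foldl_cat /= -!/(nest _ _).
by rewrite (br_ext_comm (nest_deg hX hu) ha hb) nestZ.
Qed.

(** Graded symmetry, for the part of the brackets with values in [M]. *)
Lemma nested_sum_swap u a b v : homog_word (u ++ a :: b :: v) ->
  nested_sum (letters (u ++ a :: b :: v)) =
    sgn K (a.1 * b.1) *: nested_sum (letters (u ++ b :: a :: v)).
Proof.
elim: u => [|x u ih] /=; last first.
  move=> /homog_word_cons[[hx _] h].
  by rewrite ih // (nest_swap hx h) brZr; linear_eq K.
move=> /homog_word_cons[[ha1 ha2] /homog_word_cons[[hb1 hb2] hv]].
rewrite -!/(nest _ _) -!/(letters _).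
rewrite (sgM_deg ha2) (sgM_deg hb2) !eZ !brZl !brBr !brZr.
(* the terms of a and of b are exchanged, the others are symmetric in a, b *)
rewrite (br_ext_left_comm (nested_sum_deg hv) ha2 hb2).
rewrite (br_ext_nest hb1 ha2 hv) (br_ext_nest ha1 hb2 hv).
rewrite (br_anti (e_deg ha2) hb1) (br_anti (e_deg hb2) ha1).
rewrite -![- (sgn K _ *: _)]scaleNr !nestZ !mulrDr !mulr1 !sgnD (mulrC b.1 a.1).
case: (sgnP K (a.1 * b.1)) => ->; case: (sgnP K a.1) => ->;
case: (sgnP K b.1) => ->; linear_eq K.
Qed.

Lemma binary_part_swap u a b v : homog_word (u ++ a :: b :: v) ->
  binary_part (letters (u ++ a :: b :: v)) =
    sgn K (a.1 * b.1) *: binary_part (letters (u ++ b :: a :: v)).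
Proof.
case: u => [|x [|y u]] /=; last first.
- by rewrite /letters !map_cat /=; case: u => *; rewrite /= scaler0.
- by rewrite scaler0.
case: v => [|c v]; last by rewrite /= scaler0.
move=> /homog_word_cons[[ha _] /homog_word_cons[[hb _] _]] /=.
rewrite (sg_deg ha) (sg_deg hb) !brZl (br_anti ha hb).
rewrite !mulrDr !mulrDl !mulr1 !mul1r !sgnD sgn1.
case: (sgnP K (a.1 * b.1)) => ->; case: (sgnP K a.1) => ->;
case: (sgnP K b.1) => ->; linear_eq K.
Qed.

Lemma derived_bracket_swap u a b v : homog_word (u ++ a :: b :: v) ->
  l (letters (u ++ a :: b :: v)) =
    sgn K (a.1 * b.1) *: l (letters (u ++ b :: a :: v)).
Proof. by move=> h; rewrite /l (binary_part_swap h) (nested_sum_swap h) PZ. Qed.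

(** * Words with entries in L or in M *)

Local Notation PT := (int * (L + M))%type.
Implicit Type (z : seq (L + M)).

(** A word with each letter either in [L] or in [M], as a word in the sum. *)
Definition pure_word (r : seq PT) : seq T := [seq (p.1, emb p.2) | p <- r].
(** The number of letters in [L], and in [M]. *)
Definition nL z := count (fun x => is_inl x) z.
Definition nM z := count (fun x => ~~ is_inl x) z.
Definition emb_word z : seq E := [seq emb x | x <- z].

Lemma letters_pure_word r : letters (pure_word r) = emb_word [seq p.2 | p <- r].
Proof. by rewrite /letters /pure_word /emb_word -!map_comp. Qed.

Lemma nest_emb_word X z : (0 < nL z)%N -> nest X [seq y.2 | y <- emb_word z] = 0.
Proof.
rewrite -has_count => /hasP[[Y|//] hY _]; apply: nest_mem0.
by apply/mapP; exists (Y, 0) => //; apply/mapP; exists (inl Y).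
Qed.

Lemma nested_sum_emb_word z : nL z != 1%N -> nested_sum (emb_word z) = 0.
Proof.
elim: z => //= -[X|f] z ih; rewrite /nL /= => h.
  by rewrite nest_emb_word ?sgM0 ?e0 ?br0l ?subr0 // lt0n.
by rewrite -/(emb_word _) ih // nest0 br0r subr0.
Qed.

Lemma binary_part_emb_word z :
  (nL z, nM z) != (2, 0)%N -> binary_part (emb_word z) = 0.
Proof.
by case: z => [|[X|f] [|[Y|g] [|y z]]] //= _; rewrite ?sg0 ?br0l ?br0r.
Qed.

(** The vanishing components of the brackets. *)
Lemma derived_bracket_emb_word0 z :
  nL z != 1%N -> (nL z, nM z) != (2, 0)%N -> l (emb_word z) = 0.
Proof. by move=> h1 h2; rewrite /l binary_part_emb_word // nested_sum_emb_word // P0. Qed.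

Lemma derived_bracket_emb_word1 z : nL z = 1%N ->
  l (emb_word z) = emb (inr (P (nested_sum (emb_word z)))).
Proof. by move=> h; rewrite /l binary_part_emb_word // h. Qed.

Lemma derived_bracket_emb_word2 z : nL z = 2%N ->
  l (emb_word z) = emb (inl (binary_part (emb_word z))).
Proof. by move=> h; rewrite /l nested_sum_emb_word ?P0 // h. Qed.

Lemma emb_word_cons x z : emb x :: emb_word z = emb_word (x :: z).
Proof. by []. Qed.

Lemma nL_inl X z : nL (inl X :: z) = (nL z).+1. Proof. by []. Qed.
Lemma nL_inr f z : nL (inr f :: z) = nL z. Proof. by []. Qed.
Lemma nM_inl X z : nM (inl X :: z) = nM z. Proof. by []. Qed.
Lemma nM_inr f z : nM (inr f :: z) = (nM z).+1. Proof. by []. Qed.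
Lemma nL_cat z1 z2 : nL (z1 ++ z2) = (nL z1 + nL z2)%N. Proof. exact: count_cat. Qed.
Lemma nM_cat z1 z2 : nM (z1 ++ z2) = (nM z1 + nM z2)%N. Proof. exact: count_cat. Qed.

(** A term of the Jacobi identity vanishes unless two of the entries are in [L],
    or three of them and no entry is in [M]. *)
Lemma jacobi_term_eq0 z1 z2 :
  nL (z1 ++ z2) != 2%N -> (nL (z1 ++ z2), nM (z1 ++ z2)) != (3, 0)%N ->
  l (l (emb_word z1) :: emb_word z2) = 0.
Proof.
rewrite nL_cat nM_cat => h2 h3.
have [e1|n1] := eqVneq (nL z1) 1%N.
  rewrite derived_bracket_emb_word1 // emb_word_cons derived_bracket_emb_word0 //.
    by apply: contra h2; rewrite nL_inr e1 => /eqP ->.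
  by rewrite nM_inr xpair_eqE andbF.
have [e2|n2] := eqVneq (nL z1, nM z1) (2, 0)%N; last first.
  by rewrite (derived_bracket_emb_word0 n1 n2) derived_bracket0.
case: e2 => e2 e2'; rewrite derived_bracket_emb_word2 // emb_word_cons.
rewrite derived_bracket_emb_word0 //.
  by apply: contra h2; rewrite nL_inl e2 => /eqP[->].
by apply: contra h3; rewrite nL_inl nM_inl e2 e2' => /eqP[-> ->].
Qed.

(** * The Jacobi identity *)

(** The left-hand side of the Jacobi identity, including the terms with an empty
    inner word, which vanish. *)
Definition jacobiator (r : seq T) : E :=
  unshuffle_sum (fun S T => l (l (letters S) :: letters T)) r.

Lemma jacobiator_swap u a b v : homog_word (u ++ a :: b :: v) ->
  jacobiator (u ++ a :: b :: v) = sgn K (a.1 * b.1) *: jacobiator (u ++ b :: a :: v).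
Proof.
move=> h; apply: unshuffle_sum_swap => [S S' R|S R R'];
  move=> /homog_word_perm/(_ h)/homog_word_cat[hS hR].
  by rewrite derived_bracket_swap // derived_bracketZ.
pose y : T := (word_degree S + 1, l (letters S)).
have hy : homog_word ((y :: R) ++ a :: b :: R').
  by apply/homog_word_cons; split; [exact: derived_bracket_deg|exact: hR].
exact: (derived_bracket_swap hy).
Qed.

Lemma jacobiator_add u d x y t :
  jacobiator (u ++ (d, x + y) :: t) =
    jacobiator (u ++ (d, x) :: t) + jacobiator (u ++ (d, y) :: t).
Proof.
apply: unshuffle_sum_add => [S S' R|S R R']; rewrite /letters !map_cat /=.
  by rewrite derived_bracketD (derived_bracketD [::]).
exact: (derived_bracketD (_ :: _)).
Qed.

Lemma jacobiator_pure_word (r : seq PT) : jacobiator (pure_word r) =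
  unshuffle_sum (fun S R =>
    l (l (emb_word [seq p.2 | p <- S]) :: emb_word [seq p.2 | p <- R])) r.
Proof.
rewrite /jacobiator unshuffle_sum_map //; congr (unshuffle_sum _ r).
by apply/funext => S; apply/funext => R; rewrite !letters_pure_word.
Qed.

Lemma jacobiator_pure_word_eq0 (r : seq PT) :
  nL [seq p.2 | p <- r] != 2%N ->
  (nL [seq p.2 | p <- r], nM [seq p.2 | p <- r]) != (3, 0)%N ->
  jacobiator (pure_word r) = 0.
Proof.
move=> h2 h3; rewrite jacobiator_pure_word; apply: unshuffle_sum_eq0 => S R h.
have {}h : perm_eq ([seq p.2 | p <- S] ++ [seq p.2 | p <- R]) [seq p.2 | p <- r].
  by rewrite -map_cat; exact: perm_map.
by apply: jacobi_term_eq0; rewrite /nL /nM !(seq.permP h).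
Qed.

(** The main identity.  In the induction on [r], bracketing with the first
    letter [p] is distributed over [X] and [Y]; on the right-hand side this
    matches the choice of the word to which [p] belongs, because the bracket of
    two elements that come from [M] vanishes. *)
Lemma P_nest_br m n X Y (r : seq (int * M)) : gL m X -> gL n Y -> homog_Mword r ->
  P (nest (br X Y) [seq p.2 | p <- r]) =
  unshuffle_sum (fun S R =>
    P (nest (br X (e (P (nest Y [seq p.2 | p <- S])))) [seq p.2 | p <- R]) -
    sgn K (m * n) *:
    P (nest (br Y (e (P (nest X [seq p.2 | p <- S])))) [seq p.2 | p <- R])) r.
Proof.
elim: r m n X Y => [|p r ih] m n X Y hX hY /=.
  move=> _; rewrite P_br (br_anti (e_deg (P_deg hX)) hY) -scaleNr PZ.
  by rewrite scaleNr.
move=> /homog_Mword_cons[hp hr]; have he := e_deg hp.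
rewrite (br_jacobi hX hY he) nestD nestZ PD PZ.
rewrite (ih _ _ _ _ hX (br_deg hY he) hr) (ih _ _ _ _ (br_deg hX he) hY hr).
rewrite -unshuffle_sumZ -!unshuffle_sumD; apply: unshuffle_sum_ext => S R h.
have hS : homog_Mword S.
  by move=> q hq; apply: hr; rewrite -(perm_mem h) mem_cat hq.
have hX' := e_deg (P_deg (nest_deg_Mword hX hS)).
have hY' := e_deg (P_deg (nest_deg_Mword hY hS)).
rewrite (br_jacobi hX hY' he) (br_jacobi hY hX' he) !br_ee !br0r !add0r.
rewrite !nestZ !PZ !mulrDr !mulrDl !sgnD (mulrC p.1 n) (mulrC p.1 (word_degree S)).
case: (sgnP K (m * n)) => ->; case: (sgnP K (word_degree S * p.1)) => ->;
case: (sgnP K (n * p.1)) => ->; linear_eq K.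
Qed.

Lemma derived_bracket_inl X (fs : seq M) :
  l (emb_word (inl X :: [seq inr f | f <- fs])) = emb (inr (P (nest X fs))).
Proof.
rewrite derived_bracket_emb_word1; last first.
  by rewrite nL_inl /nL count_map (eq_count (a2 := pred0)) ?count_pred0.
rewrite /= sgM0 e0 br0l subr0 -map_comp -map_comp.
by rewrite (@eq_map _ _ _ id) ?map_id.
Qed.

Lemma derived_bracket_inr_inl g X (fs : seq M) :
  l (emb_word (inr g :: inl X :: [seq inr f | f <- fs])) =
  emb (inr (- P (br (e (sgM g)) (nest X fs)))).
Proof.
have h0 : nL [seq inr f | f <- fs] = 0%N.
  by rewrite /nL count_map (eq_count (a2 := pred0)) ?count_pred0.
rewrite derived_bracket_emb_word1 ?nL_inr ?nL_inl ?h0 //.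
rewrite /= br0l nest0 sgM0 e0 br0l subr0 sub0r -map_comp -map_comp.
by rewrite (@eq_map _ _ _ id) ?map_id // PN.
Qed.

Lemma derived_bracket_inr (fs : seq M) : l (emb_word [seq inr f | f <- fs]) = 0.
Proof.
have h0 : nL [seq inr f | f <- fs] = 0%N.
  by rewrite /nL count_map (eq_count (a2 := pred0)) ?count_pred0.
by rewrite derived_bracket_emb_word0 ?xpair_eqE ?h0.
Qed.

(** The Jacobi identity for two entries in [L] and the others in [M]. *)
Lemma jacobiator_two (a b : int) X Y (r : seq (int * M)) :
  gL (a + 1) X -> gL (b + 1) Y -> homog_Mword r ->
  jacobiator (pure_word [:: (a, inl X), (b, inl Y) & [seq (p.1, inr p.2) | p <- r]]) = 0.
Proof.
move=> hX hY hr; rewrite jacobiator_pure_word /= !unshuffle_sum_map //.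
have mE (S : seq (int * M)) : [seq p.2 | p <- [seq (p.1, inr p.2 : L + M) | p <- S]] =
    [seq inr f | f <- [seq p.2 | p <- S]] by rewrite -!map_comp.
have dE (S : seq (int * M)) : word_degree [seq (p.1, inr p.2 : L + M) | p <- S] =
  word_degree S.
  by rewrite /word_degree big_map.
have inrZ c f : emb (inr (c *: f)) = c *: emb (inr f : L + M).
  by congr pair; rewrite /= scaler0.
have inrD f g : emb (inr (f + g)) = emb (inr f : L + M) + emb (inr g).
  by congr pair; rewrite /= addr0.
have add4 (x1 x2 x3 x4 : E) y : x1 = y -> x2 + x3 = - y -> x4 = 0 ->
    x1 + x2 + (x3 + x4) = 0.
  by move=> -> h ->; rewrite addr0 -addrA h subrr.
apply: (add4 _ _ _ _
  (emb (inr (sgn K (a + 1) *: P (nest (br X Y) [seq p.2 | p <- r]))))).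
- (* X and Y both inside: no other entry can be inside *)
  rewrite -PZ -nestZ -brZl -(sg_deg hX).
  pose G (R : seq (int * M)) :=
    l ((br (sg X) Y, 0) :: emb_word [seq inr f | f <- [seq p.2 | p <- R]]).
  rewrite (@unshuffle_sum_ext _ _ _ _ (fun S R => if S is [::] then G R else 0)).
    by rewrite unshuffle_sum_nil -derived_bracket_inl.
  move=> S R _; rewrite !mE; case: S => [|s S].
    rewrite /= /G; congr (l (_ :: _)).
    by rewrite /l /= sgM0 e0 br0r !br0l !subr0 P0.
  have z : l (emb_word [:: inl X, inl Y & [seq inr f | f <- [seq p.2 | p <- s :: S]]]) = 0.
    by rewrite derived_bracket_emb_word0 // !nM_inl xpair_eqE andbF.
  by move: z => /= ->; rewrite derived_bracket0.
- (* X inside and Y outside, or the converse *)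
  rewrite (P_nest_br hX hY hr) -unshuffle_sumD -scaleN1r.
  rewrite [RHS](_ : _ = unshuffle_sum (fun S R => emb (inr (- sgn K (a + 1) *: (
    P (nest (br X (e (P (nest Y [seq p.2 | p <- S])))) [seq p.2 | p <- R]) -
    sgn K ((a + 1) * (b + 1)) *:
    P (nest (br Y (e (P (nest X [seq p.2 | p <- S])))) [seq p.2 | p <- R]))))) r).
    apply: unshuffle_sum_ext => S R h.
    have hS : homog_Mword S by move=> q hq; apply: hr;
      rewrite -(perm_mem h) mem_cat hq.
    have hR : homog_Mword R by move=> q hq; apply: hr;
      rewrite -(perm_mem h) mem_cat hq orbT.
    have hPX := P_deg (nest_deg_Mword hX hS);
      have hPY := P_deg (nest_deg_Mword hY hS).
    rewrite !mE !derived_bracket_inl !derived_bracket_inr_inl.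
    rewrite -!inrZ -inrD word_degree_cons /= !dE; congr (emb (inr _)).
    rewrite (sgM_deg hPX) (sgM_deg hPY) !eZ !brZl !PZ.
    rewrite (br_ext_nest_Mword hY hPX hR) (br_ext_nest_Mword hX hPY hR).
    rewrite (br_anti (e_deg hPX) hY) (br_anti (e_deg hPY) hX) -!scaleNr !nestZ !PZ.
    rewrite !mulrDr !mulrDl !mulr1 !mul1r !sgnD !sgn1.
    rewrite (mulrC (word_degree S) b) (mulrC (word_degree S) a) (mulrC b a).
    case: (sgnP K (a * b)) => ->; case: (sgnP K (a * word_degree S)) => ->;
    case: (sgnP K (b * word_degree S)) => ->; case: (sgnP K a) => ->;
    case: (sgnP K b) => ->; case: (sgnP K (word_degree S)) => ->; linear_eq K.
  rewrite (@unshuffle_sum_linear _ _ _ _ (fun f => emb (inr f : L + M))).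
    by rewrite unshuffle_sumZ !inrZ; linear_eq K.
  by move=> c f f'; rewrite inrD inrZ.
- (* X and Y both outside: the inner bracket vanishes *)
  apply: unshuffle_sum_eq0 => S R _.
  by rewrite !mE derived_bracket_inr derived_bracket0 !scaler0.
Qed.

Lemma derived_bracket1 X f : l [:: (X, f)] = (0, P X).
Proof. by rewrite /l /= br0r subr0. Qed.

Lemma derived_bracket_inl2 X Y : l [:: (X, 0); (Y, 0)] = (br (sg X) Y, 0).
Proof. by rewrite /l /= sgM0 e0 br0r !br0l !subr0 P0. Qed.

(** The Jacobi identity for three entries in [L] is that of the bracket. *)
Lemma jacobiator_three (a b c : int) X Y Z :
  gL (a + 1) X -> gL (b + 1) Y -> gL (c + 1) Z ->
  jacobiator (pure_word [:: (a, inl X); (b, inl Y); (c, inl Z)]) = 0.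
Proof.
move=> hX hY hZ; rewrite /jacobiator /pure_word /= /letters /=.
have l3 X1 X2 X3 : l [:: (X1, 0); (X2, 0); (X3, 0)] = 0.
  exact: (@derived_bracket_emb_word0 [:: inl X1; inl X2; inl X3]).
have l12 X1 X2 X3 : l [:: l [:: (X1, 0)]; (X2, 0); (X3, 0)] = 0.
  rewrite (derived_bracket_inl X1 [::]).
  exact: (@derived_bracket_emb_word0 [:: inr _; inl X2; inl X3]).
have l0 : l [::] = 0 by rewrite /l /= P0.
rewrite !l3 !l12 l0 !derived_bracket0 !derived_bracket_inl2.
rewrite (sg_deg hX) (sg_deg hY) !brZl.
rewrite /word_degree !big_cons !big_nil /= !addr0 !mulr0.
have sgZ k U : sg (k *: U) = k *: sg U by exact: linear_scale.
rewrite !sgZ (sg_deg (br_deg hX hY)) (sg_deg (br_deg hX hZ)) (sg_deg (br_deg hY hZ)).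
have inlZ k U : k *: ((U, 0) : E) = (k *: U, 0) by congr pair; rewrite /= scaler0.
have inlD U V : ((U, 0) : E) + (V, 0) = (U + V, 0) by congr pair; rewrite /= addr0.
rewrite sgn0 !scaler0 !scale1r !add0r !addr0 !inlZ !inlD !brZl.
rewrite (br_jacobi hX hY hZ) (br_anti (br_deg hY hZ) hX).
rewrite -[- (sgn K _ *: _)]scaleNr.
rewrite !mulrDr !mulrDl !mulr1 !mul1r !sgnD !sgn1 (mulrC b a) (mulrC c a).
have pair0 U : U = 0 -> ((U, 0) : E) = 0 by move=> ->.
apply: pair0.
case: (sgnP K (a * b)) => ->; case: (sgnP K (a * c)) => ->;
case: (sgnP K (b * c)) => ->; case: (sgnP K a) => ->;
case: (sgnP K b) => ->; case: (sgnP K c) => ->; linear_eq K.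
Qed.

Lemma jacobiator_perm (r r' : seq T) :
  perm_eq r r' -> homog_word r -> jacobiator r = 0 -> jacobiator r' = 0.
Proof.
move=> h hr h0; suff [] : homog_word r' /\ jacobiator r' = 0 by [].
move: h (conj hr h0); apply: (perm_eq_swap (Q := fun r => homog_word r /\ jacobiator r = 0)).
move=> u a b v [hw]; rewrite (jacobiator_swap hw) => hj; split.
  apply: homog_word_perm hw; rewrite perm_cat2l.
  by rewrite -(cat1s b) -(cat1s a) perm_catCA.
by rewrite -[LHS]scale1r -(sgnn K (a.1 * b.1)) -scalerA hj scaler0.
Qed.

Lemma jacobiator_pure_word_homog (r : seq PT) :
  homog_word (pure_word r) -> jacobiator (pure_word r) = 0.
Proof.
move=> hr.
have [h|] := boolP ((nL [seq p.2 | p <- r] != 2%N) &&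
    ((nL [seq p.2 | p <- r], nM [seq p.2 | p <- r]) != (3, 0)%N)).
  by case/andP: h; exact: jacobiator_pure_word_eq0.
(* by symmetry, the letters in L may be placed first *)
pose isL (p : PT) := is_inl p.2.
have h1 : perm_eq (filter isL r ++ filter (predC isL) r) r by rewrite perm_filterC.
have {}h1 := perm_map (fun p : PT => (p.1, emb p.2)) h1.
have nLE : nL [seq p.2 | p <- r] = size (filter isL r).
  by rewrite /nL count_map size_filter.
have nME : nM [seq p.2 | p <- r] = size (filter (predC isL) r).
  by rewrite /nM count_map size_filter.
have hs := homog_word_perm h1 hr.
rewrite negb_and !negbK nLE nME => hn.
apply: (jacobiator_perm h1 hs) => {h1 hr nLE nME}.
rewrite -/(pure_word _).
have hL : all isL (filter isL r) by exact: filter_all.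
have hM : all (predC isL) (filter (predC isL) r) by exact: filter_all.
move: hL hM hs hn; rewrite -/(pure_word _).
move: (filter isL r) (filter (predC isL) r) => u v hu hv.
have {hu} [u' ->] : exists u', u = [seq (p.1, inl p.2) | p <- u'].
  elim: u hu => [|[d [X|//]] u ih] /=; first by exists [::].
  by move=> /ih[u' ->]; exists ((d, X) :: u').
rewrite size_map => hs /orP[/eqP hn|/eqP[hn hn']].
- have {hv} [v' ev] : exists v', v = [seq (p.1, inr p.2) | p <- v'].
    elim: v hv {hs} => [|[d [//|f]] v ih] /=; first by exists [::].
    by move=> /ih[v' ->]; exists ((d, f) :: v').
  rewrite {}ev in hs *.
  case: u' hn hs => [|[a X] [|[b Y] [|]]] //= _.
  move=> /homog_word_cons[[hX _] /homog_word_cons[[hY _] hv']].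
  apply: jacobiator_two => // p hp.
  have [|_ //] := hv' (p.1, (0, p.2)).
  by apply/mapP; exists (p.1, inr p.2) => //; apply/mapP; exists p.
- rewrite (size0nil hn') in hs *.
  case: u' hn hs => [|[a X] [|[b Y] [|[c Z] [|]]]] //= _.
  move=> /homog_word_cons[[hX _] /homog_word_cons[[hY _] /homog_word_cons[[hZ _] _]]].
  exact: jacobiator_three.
Qed.

Lemma jacobiator_eq0 (r : seq T) : homog_word r -> jacobiator r = 0.
Proof.
(* each entry is split into its components in L and in M, from left to right *)
suff H t u : homog_word (pure_word u ++ t) -> jacobiator (pure_word u ++ t) = 0.
  exact: (H r [::]).
elim: t u => [|[d [X f]] t ih] u.
  by rewrite cats0; exact: jacobiator_pure_word_homog.
move=> h; have /homog_word_cat[hu /homog_word_cons[[/= hX hf] ht]] := h.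
have -> : (X, f) = (X, 0) + (0, f) :> E.
  by congr pair; rewrite /= ?addr0 ?add0r.
rewrite jacobiator_add.
have E1 : pure_word u ++ (d, (X, 0)) :: t = pure_word (rcons u (d, inl X)) ++ t.
  by rewrite /pure_word map_rcons cat_rcons.
have E2 : pure_word u ++ (d, (0, f)) :: t = pure_word (rcons u (d, inr f)) ++ t.
  by rewrite /pure_word map_rcons cat_rcons.
rewrite E1 E2 !ih ?addr0 // -?E1 -?E2; apply/homog_word_cat; split=> //;
  apply/homog_word_cons; split=> //; split=> //=; exact: homog0.
Qed.

Lemma letters_map N (d : 'I_N -> int) (x : 'I_N -> E) (r : seq 'I_N) :
  letters [seq (d i, x i) | i <- r] = [seq x i | i <- r].
Proof. by rewrite /letters -map_comp. Qed.

Lemma word_sign_perm N (d : 'I_N -> int) (x : 'I_N -> E) (r r' : seq 'I_N) :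
  (forall i, gE (d i) (x i)) -> perm_eq r r' ->
  word_sign K d r *: l [seq x i | i <- r] = word_sign K d r' *: l [seq x i | i <- r'].
Proof.
move=> hx h; pose Q t := word_sign K d r *: l [seq x i | i <- r] =
  word_sign K d t *: l [seq x i | i <- t].
apply: (perm_eq_swap (Q := Q)) h _; rewrite /Q // => u a b v ->.
have [->//|ab] := eqVneq a b.
have hw : homog_word [seq (d i, x i) | i <- u ++ a :: b :: v].
  by move=> p /mapP[i _ ->]; exact: hx.
move: hw; rewrite (word_sign_swap K d u v ab) -!(letters_map d) !map_cat /= => hw.
rewrite (derived_bracket_swap hw) /= scalerA mulrAC sgnn mul1r.
by [].
Qed.

Theorem derived_bracket_Linfty : Linfty_algebra gE l.
Proof.
have hw N (d : 'I_N -> int) (x : 'I_N -> E) : (forall i, gE (d i) (x i)) ->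
    homog_word [seq (d i, x i) | i : 'I_N].
  by move=> hx p /mapP[i _ ->]; exact: hx.
split.
- exact: derived_bracket_multilinear.
- move=> N d x _ hx; have := derived_bracket_deg (hw N d x hx).
  by rewrite letters_map /word_degree big_map big_enum.
- move=> N d x _ hx s; rewrite koszul_word_sign.
  have := word_sign_perm hx (perm_perm_word s).
  rewrite (word_sign_sorted _ _ (sorted_enum_ord N)) scale1r => <-.
  by rewrite /perm_word -map_comp.
- move=> N d x Npos hx; rewrite -[RHS](jacobiator_eq0 (hw N d x hx)) /jacobiator -shuffle_sum.
  (* the shuffles with i = 0, absent from the Jacobi identity, contribute 0 *)
  rewrite [RHS]big_nat_recl // [X in _ = X + _]big1 ?add0r; last first.
    move=> s _; rewrite take0 drop0 /= (_ : l [::] = 0) ?derived_bracket0 ?scaler0 //.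
    by rewrite /l /= P0.
  rewrite big_add1 /=; apply: eq_bigr => i _; apply: eq_bigr => s _.
  by rewrite -map_take -map_drop !letters_map /perm_word -!map_take -!map_drop -!map_comp.
Qed.

End DerivedBrackets.

(** * Insertion of a map into another *)

Section Insertion.
Context (K : fieldType) (V : lmodType K).

Lemma multilinear0 (W : lmodType K) (f : seq V -> W) s t :
  multilinear f -> f (s ++ 0 :: t) = 0.
Proof.
by move=> fl; have := fl s t (-1) 0 0; rewrite scaler0 addr0 scaleN1r addNr.
Qed.

Lemma multilinear_cons (W : lmodType K) (f : seq V -> W) v :
  multilinear f -> multilinear (fun s => f (v :: s)).
Proof. by move=> fl s t a x y; exact: (fl (v :: s)). Qed.

(** Maps with [q] + 1 inputs, that is, of degree [q]. *)
Definition arity (W : lmodType K) (q : nat) (f : seq V -> W) :=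
  forall s, size s != q.+1 -> f s = 0.

(** The sum of (-1)^(iq) f(v_1, ..., v_i, g(...), ...) over all the positions of
    [g], which reads [q] + 1 letters.  Near the end of the word fewer letters
    are left; these terms vanish when [g] has arity [q] and [f] is
    multilinear. *)
Fixpoint insertion (W : lmodType K) (q : nat) (g : seq V -> V) (f : seq V -> W)
    (s : seq V) : W :=
  if s is v :: t then
    f (g (v :: take q t) :: drop q t) +
    (-1) ^+ q *: insertion q g (fun r => f (v :: r)) t
  else 0.

Lemma insertion_ext (W : lmodType K) q g (f f' : seq V -> W) s :
  f =1 f' -> insertion q g f s = insertion q g f' s.
Proof.
elim: s f f' => //= v s ih f f' e.
by rewrite e (ih _ (fun r => f' (v :: r))) // => r; rewrite e.
Qed.

Lemma insertionP (W : lmodType K) q g a (f f' : seq V -> W) s :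
  insertion q g (fun r => a *: f r + f' r) s =
    a *: insertion q g f s + insertion q g f' s.
Proof.
elim: s f f' => [|v s ih] f f' /=; first by rewrite scaler0 addr0.
by rewrite ih; linear_eq K.
Qed.

Lemma insertionPl (W : lmodType K) q a (g g' : seq V -> V) (f : seq V -> W) s :
  multilinear f ->
  insertion q (fun r => a *: g r + g' r) f s =
    a *: insertion q g f s + insertion q g' f s.
Proof.
elim: s f => [|v s ih] f fl /=; first by rewrite scaler0 addr0.
rewrite (fl [::]) ih /=; last exact: multilinear_cons.
by linear_eq K.
Qed.

Lemma insertionZ (W : lmodType K) q g a (f : seq V -> W) s :
  insertion q g (fun r => a *: f r) s = a *: insertion q g f s.
Proof.
elim: s f => [|v s ih] f /=; first by rewrite scaler0.
by rewrite ih; linear_eq K.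
Qed.

Lemma insertionD (W : lmodType K) q g (f f' : seq V -> W) s :
  insertion q g (fun r => f r + f' r) s = insertion q g f s + insertion q g f' s.
Proof.
rewrite -[insertion q g f s]scale1r -insertionP.
by apply: insertion_ext => r; rewrite scale1r.
Qed.

Lemma insertion_multilinear (W : lmodType K) q g (f : seq V -> W) :
  multilinear g -> multilinear f -> multilinear (insertion q g f).
Proof.
move=> gl fl s; elim: s f fl => [|w s ih] f fl t a u v /=.
- rewrite (gl [::]) /= (fl [::]) /=.
  have -> : insertion q g (fun r => f (a *: u + v :: r)) t =
            insertion q g (fun r => a *: f (u :: r) + f (v :: r)) t.
    by apply: insertion_ext => r; rewrite (fl [::]).
  by rewrite insertionP; linear_eq K.
rewrite ih; last exact: multilinear_cons.
rewrite !take_cat !drop_cat; case: ltnP => h /=.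
  by rewrite -!cat_cons fl; linear_eq K.
case: (q - size s)%N => [|k] /=.
  by rewrite !cats0 (fl [:: _]) /=; linear_eq K.
by rewrite -!cat_cons gl (fl [::]) /=; linear_eq K.
Qed.

(** Insertion vanishes on words that are too short for [g]. *)
Lemma insertion_short (W : lmodType K) q g (f : seq V -> W) s :
  arity q g -> multilinear f -> (size s <= q)%N -> insertion q g f s = 0.
Proof.
move=> gq; elim: s f => //= v s ih f fl hs.
rewrite gq; last by rewrite /= size_take; case: ifP => h; lia.
rewrite (multilinear0 [::]) // add0r ih ?scaler0 //; last by lia.
exact: multilinear_cons.
Qed.

(** Degrees add up. *)
Lemma insertion_arity (W : lmodType K) p q g (f : seq V -> W) :
  multilinear f -> arity q g -> arity p f -> arity (p + q) (insertion q g f).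
Proof.
move=> fl gq; move=> fp s hs.
(* the words fed to f by the induction have this property, not arity p *)
have {fp hs}: forall r, (size r + q)%N = size s -> f r = 0.
  by move=> r hr; apply: fp; apply: contra hs => /eqP e; rewrite -hr e addSn.
elim: s f fl => //= v s ih f fl fp.
rewrite ih ?scaler0 ?addr0; first last.
- by move=> r hr; apply: fp; rewrite /= addSn hr.
- exact: multilinear_cons.
have [h|h] := leqP q (size s).
  by rewrite fp //= size_drop; lia.
rewrite gq ?(multilinear0 [::]) //= size_take; case: ifP => h'; lia.
Qed.

Lemma insertion_linear (W W' : lmodType K) q g (f : seq V -> W) (phi : W -> W') s :
  (forall a x y, phi (a *: x + y) = a *: phi x + phi y) ->
  insertion q g (fun r => phi (f r)) s = phi (insertion q g f s).
Proof.
move=> philin; have phi0 := linear_zero philin.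
elim: s f => //= v s ih f.
rewrite (ih (fun r => f (v :: r))) [X in _ = phi X]addrC philin; exact: addrC.
Qed.

(** Inserting [h] into a function that reads the first [q] letters of the word
    and the remaining ones separately: [h] takes its letters either from the
    first [q + r], its value being among the first [q], or after the first
    [q]. *)
Lemma insertion_take_drop (W : lmodType K) (q r : nat) (h : seq V -> V)
    (F : seq V -> seq V -> W) s :
  arity r h -> (forall t, multilinear (F^~ t)) ->
  insertion r h (fun u => F (take q u) (drop q u)) s =
  insertion r h (F^~ (drop (q + r) s)) (take (q + r) s) +
  (-1) ^+ (q * r) *: insertion r h (F (take q s)) (drop q s).
Proof.
move=> hr; elim: q s F => [|q ih] s F Fl.
  rewrite (@insertion_short _ _ _ _ (take _ _)) //; last first.
    by rewrite size_take; case: ifP => hs; lia.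
  rewrite add0r mul0n scale1r take0 drop0.
  by apply: insertion_ext => u; rewrite take0 drop0.
case: s => [|v s]; first by rewrite /= scaler0 addr0.
rewrite addSn /= (@take_takel _ r (q + r) s) ?leq_addl // !drop_drop.
rewrite (ih s (fun u t => F (v :: u) t)); last first.
  by move=> t; exact: (multilinear_cons v (Fl t)).
have -> : take q (drop r s) = drop r (take (q + r) s).
  by rewrite take_drop addnC.
rewrite mulSn exprD.
change [eta F (v :: take q s)] with (F (v :: take q s)).
linear_eq K.
Qed.

(** The pre-Lie identity: once the insertions of [h] into [g] are removed, [g]
    and [h] are inserted side by side into [f], and up to sign the order of
    these insertions does not matter. *)
Lemma insertion_comm (W : lmodType K) (q r : nat) (g h : seq V -> V)
    (f : seq V -> W) s :
  arity q g -> arity r h -> multilinear g -> multilinear h -> multilinear f ->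
  insertion r h (insertion q g f) s - insertion (q + r) (insertion r h g) f s =
  (-1) ^+ (q * r) *: (insertion q g (insertion r h f) s -
    insertion (r + q) (insertion q g h) f s).
Proof.
move=> gq hr gl hl; elim: s f => [|v s ih] f fl /=.
  by rewrite subrr scaler0.
have {}ih := ih _ (multilinear_cons v fl).
rewrite !insertionD !insertionZ.
rewrite (@insertion_take_drop _ q r h (fun u t => f (g (v :: u) :: t))) //;
  last first.
  by move=> t s' w a x y; rewrite (gl (v :: s')) (fl [::]).
rewrite (@insertion_take_drop _ r q g (fun u t => f (h (v :: u) :: t))) //;
  last first.
  by move=> t s' w a x y; rewrite (hl (v :: s')) (fl [::]).
rewrite (@insertion_linear _ _ r h (fun u => g (v :: u)) (fun x => f (x :: _)));
  last by move=> a x y; rewrite (fl [::]).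
rewrite (@insertion_linear _ _ q g (fun u => h (v :: u)) (fun x => f (x :: _)));
  last by move=> a x y; rewrite (fl [::]).
rewrite !(@take_takel _ _ (_ + _)) ?leq_addl // !drop_drop.
rewrite -[drop r (take (q + r) s)]take_drop.
rewrite -[drop q (take (r + q) s)]take_drop.
rewrite [h _ + _]addrC [g _ + _]addrC !(fl [::]) /=.
set a1 := f (g _ :: drop (q + r) s); set a2 := f (h _ :: drop (r + q) s).
move: ih; set d1 := insertion r h (insertion q g _) s;
  set d2 := insertion (q + r) _ _ s.
set d3 := insertion q g (insertion r h _) s;
  set d4 := insertion (r + q) _ _ s => /eqP.
rewrite subr_eq => /eqP ->.
rewrite (mulnC r q) (addnC r q) !exprD.
have := signr_odd K (q * r); have := signr_odd K q; have := signr_odd K r.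
by case: odd; case: odd; case: odd => <- <- <-; linear_eq K.
Qed.

End Insertion.

(** * The Gerstenhaber bracket *)

Section Bracket.
Context (K : fieldType) (V : lmodType K).
Implicit Types (f g h : seq V -> V) (s t : seq V).

Lemma insertionE q g f s :
  insertion q g f s = \sum_(0 <= i < size s) (-1) ^+ (i * q) *:
  f (take i s ++ g (take q.+1 (drop i s)) :: drop (i + q.+1) s).
Proof.
elim: s f => [|v s ih] f /=; first by rewrite big_nil.
rewrite big_nat_recl // ih mul0n scale1r /=; congr (_ + _).
rewrite scaler_sumr; apply: eq_bigr => i _.
by rewrite scalerA -exprD -mulSn.
Qed.

(** The component of [g] with [q] + 1 inputs. *)
Definition cut q g s := if size s == q.+1 then g s else 0.

Lemma cut_arity q g : arity q (cut q g).
Proof. by move=> s /negbTE hs; rewrite /cut hs. Qed.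

Lemma cut_multilinear q g : multilinear g -> multilinear (cut q g).
Proof.
move=> gl s t a x y; rewrite /cut !size_cat /=.
by case: ifP => _; rewrite ?gl // scaler0 addr0.
Qed.

Lemma diamond_cut f g p q s : multilinear f -> size s = (p + q).+1 ->
  diamond f g p q s = insertion q (cut q g) f s.
Proof.
move=> fl hs; rewrite insertionE /diamond [RHS](@big_cat_nat _ _ _ p.+1) /=; try lia.
(* the remaining positions leave fewer than q + 1 letters to g *)
rewrite [X in _ = _ + X]big_nat [X in _ = _ + X]big1 ?addr0 => [|i hi]; last first.
  rewrite /= cut_arity ?multilinear0 ?scaler0 // size_take size_drop.
  by case: ifP => h; lia.
apply: eq_big_nat => i hi; congr (_ *: f (_ ++ _ :: _)).
rewrite /cut size_take size_drop ifT //; case: ifP => h; apply/eqP; lia.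
Qed.

Lemma diamond_insertion f g p q s : multilinear f -> arity q g ->
  size s = (p + q).+1 -> diamond f g p q s = insertion q g f s.
Proof.
move=> fl gq hs; rewrite diamond_cut // !insertionE; apply: eq_bigr => i _.
rewrite /cut; case: eqP => // /eqP h; by rewrite gq.
Qed.

Lemma diamond_arityl f g p p' q s : arity p f -> p' != p ->
  size s = (p' + q).+1 -> diamond f g p' q s = 0.
Proof.
move=> fp np hs; rewrite /diamond big_nat big1 // => i hi.
by rewrite fp ?scaler0 // size_cat /= size_take size_drop; case: ifP => h; lia.
Qed.

Lemma diamond_arityr f g p q q' s : multilinear f -> arity q g -> q' != q ->
  size s = (p + q').+1 -> diamond f g p q' s = 0.
Proof.
move=> fl gq nq hs; rewrite /diamond big_nat big1 // => i hi.
rewrite gq ?multilinear0 ?scaler0 // size_take size_drop; case: ifP => h; lia.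
Qed.

Lemma diamondPl a f f' g p q s :
  diamond (a *: f + f') g p q s = a *: diamond f g p q s + diamond f' g p q s.
Proof.
rewrite /diamond scaler_sumr -big_split; apply: eq_bigr => i _ /=.
by rewrite addrfctE scalrfctE; linear_eq K.
Qed.

Lemma diamondPr a f g g' p q s : multilinear f ->
  diamond f (a *: g + g') p q s = a *: diamond f g p q s + diamond f g' p q s.
Proof.
move=> fl; rewrite /diamond scaler_sumr -big_split; apply: eq_bigr => i _ /=.
by rewrite addrfctE scalrfctE fl; linear_eq K.
Qed.

Lemma bracketPl a f f' g s : multilinear g ->
  bracket (a *: f + f') g s = a *: bracket f g s + bracket f' g s.
Proof.
move=> gl; rewrite /bracket scaler_sumr -big_split; apply: eq_bigr => p _ /=.
by rewrite diamondPl diamondPr //; linear_eq K.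
Qed.

Lemma bracketPr a f g g' s : multilinear f ->
  bracket f (a *: g + g') s = a *: bracket f g s + bracket f g' s.
Proof.
move=> fl; rewrite /bracket scaler_sumr -big_split; apply: eq_bigr => p _ /=.
by rewrite diamondPl diamondPr //; linear_eq K.
Qed.

Lemma bracket_multilinear f g :
  multilinear f -> multilinear g -> multilinear (bracket f g).
Proof.
move=> fl gl s t a u v.
pose n := size (s ++ u :: t).
have E w : bracket f g (s ++ w :: t) = \sum_(0 <= p < n)
   (insertion (n.-1 - p) (cut (n.-1 - p) g) f (s ++ w :: t) -
    (-1) ^+ (p * (n.-1 - p)) *: insertion p (cut p f) g (s ++ w :: t)).
  have e : size (s ++ w :: t) = n by rewrite /n !size_cat.
  rewrite /bracket e; apply: eq_big_nat => p hp.
  by rewrite !diamond_cut // e; lia.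
rewrite !{}E scaler_sumr -big_split; apply: eq_bigr => p _ /=.
rewrite !insertion_multilinear //; try exact: cut_multilinear.
linear_eq K.
Qed.

Lemma bracket_is_mhom (f g : mhom V V) : is_mhom (bracket f g).
Proof.
have /asboolP[f0 fl [M fM]] : is_mhom f := valP f.
have /asboolP[g0 gl [N gN]] : is_mhom g := valP g.
apply/asboolP; split.
- by rewrite /bracket big_nil.
- exact: bracket_multilinear.
- exists (M + N)%N => s hs; rewrite /bracket big_nat big1 // => p hp.
  have small (f' g' : mhom V V) p' q' M' N' : multilinear f' ->
      (forall r, (M' < size r)%N -> f' r = 0) ->
      (forall r, (N' < size r)%N -> g' r = 0) ->
      size s = (p' + q').+1 -> (M' + N' < size s)%N ->
      diamond f' g' p' q' s = 0.
    move=> fl' fM' gN' e h; rewrite /diamond big_nat big1 // => i hi.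
    have [hq|hq] := ltnP N' q'.+1.
      rewrite gN' ?multilinear0 ?scaler0 // size_take size_drop.
      by case: ifP => h'; lia.
    rewrite fM' ?scaler0 // size_cat /= size_take size_drop.
    by case: ifP => h'; lia.
  rewrite (small f g _ _ M N) ?(small g f _ _ N M) ?scaler0 ?subr0 //; lia.
Qed.

(** The Gerstenhaber bracket on Hom(T V, V). *)
Definition mhom_bracket (f g : mhom V V) : mhom V V := Mhom (bracket_is_mhom f g).

Lemma mhom_multilinear (W : lmodType K) (f : mhom V W) : multilinear f.
Proof. by have /asboolP[] : is_mhom f := valP f. Qed.

Lemma mhom_nil (W : lmodType K) (f : mhom V W) : f [::] = 0.
Proof. by have /asboolP[] : is_mhom f := valP f. Qed.

Lemma mhom_eq (W : lmodType K) (f g : mhom V W) : f =1 g -> f = g.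
Proof. by move=> e; apply: val_inj; apply/funext. Qed.

Lemma mhom_bracketPl a X Y Z :
  mhom_bracket (a *: X + Y) Z = a *: mhom_bracket X Z + mhom_bracket Y Z.
Proof. by apply: mhom_eq => s; exact: (bracketPl _ _ _ _ (mhom_multilinear Z)). Qed.

Lemma mhom_bracketPr a X Y Z :
  mhom_bracket Z (a *: X + Y) = a *: mhom_bracket Z X + mhom_bracket Z Y.
Proof. by apply: mhom_eq => s; exact: (bracketPr _ _ _ _ (mhom_multilinear Z)). Qed.

Lemma bracket_insertion f g p q s : multilinear f -> multilinear g ->
  arity p f -> arity q g ->
  bracket f g s = insertion q g f s - (-1) ^+ (p * q) *: insertion p f g s.
Proof.
move=> fl gl fp gq; rewrite /bracket.
have [hs|hs] := eqVneq (size s) (p + q).+1.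
  rewrite (bigD1_seq p) ?mem_index_iota ?iota_uniq //=; last by lia.
  have -> : ((size s).-1 - p)%N = q by rewrite hs /=; lia.
  rewrite !diamond_insertion ?(addnC q) // big1_seq ?addr0 // => p'.
  rewrite mem_index_iota => /andP[np hp'].
  by rewrite (diamond_arityl _ fp) ?(diamond_arityr _ fp) ?scaler0 ?subr0 //; lia.
rewrite (insertion_arity fl gq fp) // (insertion_arity gl fp gq) 1?addnC // scaler0 subr0.
rewrite big_nat big1 // => p' hp'.
have [e|np] := eqVneq p' p.
  have nq : ((size s).-1 - p')%N != q by lia.
  by rewrite (diamond_arityr _ gq) ?(diamond_arityl _ gq) ?scaler0 ?subr0 //; lia.
by rewrite (diamond_arityl _ fp) ?(diamond_arityr _ fp) ?scaler0 ?subr0 //; lia.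
Qed.

(** A nonzero homogeneous element has a degree that is a natural number. *)
Lemma mhom_homogE (W : lmodType K) d (f : mhom V W) : mhom_homog d f ->
  f = 0 \/ exists2 p : nat, d = p & arity p f.
Proof.
case: d => n hf; [right|left].
  exists n => // s hs; apply: hf; apply: contra hs; rewrite -PoszD addn1.
  by move=> /eqP[->].
apply: mhom_eq => s; case: s => [|v s]; first by rewrite mhom_nil.
by apply: hf; rewrite /=; lia.
Qed.

Lemma mhom_bracket0r X : mhom_bracket X 0 = 0.
Proof. exact: (@linear_zero _ _ _ (mhom_bracket X) (fun a Y Z => mhom_bracketPr a Y Z X)). Qed.

Lemma mhom_bracket0l X : mhom_bracket 0 X = 0.
Proof.
exact: (@linear_zero _ _ _ (fun Y => mhom_bracket Y X) (fun a Y Z => mhom_bracketPl a Y Z X)).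
Qed.

Lemma mhom_bracket_homog m n X Y :
  mhom_homog m X -> mhom_homog n Y -> mhom_homog (m + n) (mhom_bracket X Y).
Proof.
move=> /mhom_homogE[->|[p -> hX]]; first by rewrite mhom_bracket0l.
move=> /mhom_homogE[->|[q -> hY]]; first by rewrite mhom_bracket0r.
have Xl := mhom_multilinear X; have Yl := mhom_multilinear Y.
move=> s hs /=; rewrite (bracket_insertion _ Xl Yl hX hY).
have {}hs : size s != (p + q).+1 by apply: contra hs => /eqP ->; lia.
rewrite (insertion_arity Xl hY hX) // (insertion_arity Yl hX hY) 1?addnC //.
by rewrite scaler0 subr0.
Qed.

Lemma mhom_bracket_anti m n X Y : mhom_homog m X -> mhom_homog n Y ->
  mhom_bracket X Y = - (sgn K (m * n) *: mhom_bracket Y X).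
Proof.
move=> /mhom_homogE[->|[p -> hX]];
  first by rewrite mhom_bracket0l mhom_bracket0r scaler0 oppr0.
move=> /mhom_homogE[->|[q -> hY]];
  first by rewrite mhom_bracket0l mhom_bracket0r scaler0 oppr0.
have Xl := mhom_multilinear X; have Yl := mhom_multilinear Y.
apply: mhom_eq => s.
rewrite -[RHS]/(- (sgn K (p%:Z * q%:Z) *: bracket Y X s)) /=.
rewrite (bracket_insertion _ Xl Yl hX hY) (bracket_insertion _ Yl Xl hY hX) -PoszM /sgn.
rewrite mulnC /exprz /=; have := signr_odd K (q * p).
by case: odd => <-; linear_eq K.
Qed.

Lemma mhom_bracket_jacobi m n p X Y Z :
  mhom_homog m X -> mhom_homog n Y -> mhom_homog p Z ->
  mhom_bracket (mhom_bracket X Y) Z =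
    mhom_bracket X (mhom_bracket Y Z) +
      sgn K (n * p) *: mhom_bracket (mhom_bracket X Z) Y.
Proof.
move=> hX' hY' hZ'.
case/mhom_homogE: (hX') => [->|[i em hX]].
  by rewrite !mhom_bracket0l scaler0 addr0.
case/mhom_homogE: (hY') => [->|[j en hY]].
  by rewrite ?(mhom_bracket0l, mhom_bracket0r) scaler0 addr0.
case/mhom_homogE: (hZ') => [->|[k ep hZ]].
  by rewrite ?(mhom_bracket0l, mhom_bracket0r) scaler0 addr0.
subst m n p.
have Xl := mhom_multilinear X; have Yl := mhom_multilinear Y.
have Zl := mhom_multilinear Z.
have ar (a b : nat) (U W : mhom V V) : mhom_homog a U -> mhom_homog b W ->
    arity (a + b)%N (bracket U W).
  move=> hU hW s hs; apply: (mhom_bracket_homog hU hW); apply: contra hs; lia.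
apply: mhom_eq => s.
rewrite -[RHS]/(bracket X (mhom_bracket Y Z) s +
   sgn K (j%:Z * k%:Z) *: bracket (mhom_bracket X Z) Y s) /=.
rewrite (bracket_insertion _ (bracket_multilinear Xl Yl) Zl (ar _ _ _ _ hX' hY') hZ).
rewrite (bracket_insertion _ Xl (bracket_multilinear Yl Zl) hX (ar _ _ _ _ hY' hZ')).
rewrite (bracket_insertion _ (bracket_multilinear Xl Zl) Yl (ar _ _ _ _ hX' hZ') hY).
have E (U W : mhom V V) a b : arity a U -> arity b W ->
    bracket U W = fun s => insertion b W U s - (-1) ^+ (a * b) *: insertion a U W s.
  by move=> hU hW; apply/funext => r;
     rewrite (bracket_insertion r (mhom_multilinear U) (mhom_multilinear W) hU hW).
rewrite (E _ _ _ _ hX hY) (E _ _ _ _ hY hZ) (E _ _ _ _ hX hZ).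
have insB a b (U : mhom V V) (f g : seq V -> V) r :
    insertion a U (fun s => f s - b *: g s) r =
      insertion a U f r - b *: insertion a U g r.
  rewrite (@insertion_ext _ _ _ _ _ _ (fun s => - b *: g s + f s)).
    by rewrite insertionP; linear_eq K.
  by move=> x; linear_eq K.
have insBl a b (U : mhom V V) (f g : seq V -> V) r :
    insertion a (fun s => f s - b *: g s) U r =
      insertion a f U r - b *: insertion a g U r.
  have -> : (fun s => f s - b *: g s) = (fun s => - b *: g s + f s).
    by apply/funext => x; linear_eq K.
  by rewrite insertionPl; [linear_eq K|exact: mhom_multilinear].
rewrite !insB !insBl.
(* one pre-Lie identity for each of X, Y, Z in the role of the outer map *)
have := insertion_comm s hY hZ Yl Zl Xl.
have := insertion_comm s hX hZ Xl Zl Yl.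
have := insertion_comm s hX hY Xl Yl Zl.
move=> /eqP; rewrite subr_eq => /eqP ->.
move=> /eqP; rewrite subr_eq => /eqP ->.
move=> /eqP; rewrite subr_eq => /eqP ->.
rewrite -PoszM /sgn /exprz /=.
rewrite (addnC k j) (addnC k i) (addnC j i).
rewrite -![(-1) ^+ (_ * _)]signr_odd !oddM !oddD.
by case: (odd i); case: (odd j); case: (odd k); rewrite /= ?expr0 ?expr1; linear_eq K.
Qed.

End Bracket.

(** * The graded Lie algebra Q *)

Section Parts.
Context (K : fieldType) (A B W : lmodType K).
Local Notation V := (A * B)%type.
Implicit Types (f g : seq V -> W) (s t : seq V).

(** The part of [f] with exactly [q] inputs from B, the other ones from A. *)
Fixpoint bpart (q : nat) f s : W :=
  if s is v :: t then
    bpart q (fun r => f ((v.1, 0) :: r)) t +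
    (if q is q'.+1 then bpart q' (fun r => f ((0, v.2) :: r)) t else 0)
  else if q == 0%N then f [::] else 0.

Lemma bpart_ext q f g s : f =1 g -> bpart q f s = bpart q g s.
Proof.
elim: s q f g => [|v s ih] q f g e /=; first by rewrite e.
rewrite (ih q _ (fun r => g ((v.1, 0) :: r))) //; case: q => // q.
by rewrite (ih q _ (fun r => g ((0, v.2) :: r))).
Qed.

Lemma bpartP q a f g s :
  bpart q (fun r => a *: f r + g r) s = a *: bpart q f s + bpart q g s.
Proof.
elim: s q f g => [|v s ih] q f g /=; first by case: ifP => _; linear_eq K.
by rewrite ih; case: q => [|q]; rewrite ?ih; linear_eq K.
Qed.

Lemma bpart_eq0 q f s : (forall r, size r = size s -> f r = 0) -> bpart q f s = 0.
Proof.
elim: s q f => [|v s ih] q f f0 /=; first by case: ifP => // _; exact: f0.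
rewrite ih ?add0r; last by move=> r e; apply: f0; rewrite /= e.
by case: q => // q; rewrite ih // => r e; apply: f0; rewrite /= e.
Qed.

Lemma bpart_multilinear q f : multilinear f -> multilinear (bpart q f).
Proof.
move=> fl s; elim: s q f fl => [|w s ih] q f fl t a u v /=.
  have El : bpart q (fun r => f (((a *: u + v).1, 0) :: r)) t =
     bpart q (fun r => a *: f ((u.1, 0) :: r) + f ((v.1, 0) :: r)) t.
    apply: bpart_ext => r; rewrite -(fl [::]) /=; congr (f (_ :: _)).
    by congr pair; rewrite /= scaler0 addr0.
  have Er q' : bpart q' (fun r => f ((0, (a *: u + v).2) :: r)) t =
     bpart q' (fun r => a *: f ((0, u.2) :: r) + f ((0, v.2) :: r)) t.
    apply: bpart_ext => r; rewrite -(fl [::]) /=; congr (f (_ :: _)).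
    by congr pair; rewrite /= scaler0 addr0.
  by rewrite El bpartP; case: q {El} => [|q]; rewrite ?Er ?bpartP; linear_eq K.
rewrite ih; last exact: multilinear_cons.
case: q => [|q]; first by linear_eq K.
by rewrite ih; [linear_eq K|exact: multilinear_cons].
Qed.

Lemma bpart_emb q f (w : seq (A + B)) : multilinear f ->
  bpart q f [seq emb x | x <- w] =
  if q == count (fun x => ~~ is_inl x) w then f [seq emb x | x <- w] else 0.
Proof.
elim: w q f => //= x w ih q f fl.
have flc v := multilinear_cons v fl.
have z q' : bpart q' (fun r => f ((0, 0) :: r)) [seq emb x | x <- w] = 0.
  apply: bpart_eq0 => r _; exact: (multilinear0 [::] r fl).
case: x => [a|b] /=.
  by rewrite ih //; case: q => [|q]; rewrite ?z addr0.
rewrite z add0r; case: q => [|q] //=; by rewrite ih.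
Qed.

Lemma bpart_large q f s : (size s < q)%N -> bpart q f s = 0.
Proof.
elim: s q f => [|v s ih] [|q] f //= h.
by rewrite !ih ?addr0 //; lia.
Qed.

(** All inputs from B. *)
Lemma bpart_size f s : bpart (size s) f s = f [seq (0, v.2) | v <- s].
Proof.
elim: s f => //= v s ih f; by rewrite bpart_large // add0r ih.
Qed.

Lemma sum_bpart f s n : multilinear f -> (size s <= n)%N ->
  \sum_(0 <= q < n.+1) bpart q f s = f s.
Proof.
elim: s f n => [|v s ih] f n fl h /=.
  by rewrite big_nat_recl //= big1 ?addr0.
case: n h => // n h; rewrite big_split /= ih; first last.
- exact: ltnW.
- exact: multilinear_cons.
rewrite big_nat_recl //= add0r ih; [|exact: multilinear_cons|by []].
have := fl [::] s 1 (v.1, 0) (0, v.2); rewrite /= !scale1r => <-.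
by congr (f (_ :: _)); case: (v) => a b; congr pair; rewrite /= ?addr0 ?add0r.
Qed.

End Parts.

Section Q.
Context (K : fieldType) (A B : lmodType K).
Local Notation V := (A * B)%type.

(** Words in B are sent into B. *)
Definition Bclosed (f : seq V -> V) :=
  forall s, all (fun v => v.1 == 0) s -> (f s).1 = 0.

Lemma inQ_Bclosed (f : mhom V V) : inQ f -> Bclosed f.
Proof.
move=> /asboolP[r [hr ->]] s hs; rewrite mhom_sumE.
elim: r hr => [|g r ih] hr; first by rewrite big_nil.
rewrite big_cons /= ih ?addr0; last by move=> h hh; apply: hr; rewrite inE hh orbT.
have [n [c [hc ->]]] := hr g (mem_head _ _); rewrite mhom_sumE.
(* the A-valued part of C^{k|l} vanishes on words in B unless k = -1 *)
rewrite big_seq; elim/big_rec: _ => // j x; rewrite mem_index_iota => hj /= ->.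
have [|_ /(_ [seq inr v.2 | v <- s])[_ h1 h2]] := hc j; first by case/andP: hj.
have e : [seq emb x | x <- [seq inr v.2 | v <- s]] = s :> seq V.
  rewrite -map_comp map_id_in // => v /(allP hs) /eqP /= <-; by case: v.
have p0 : count is_inl [seq (inr v.2 : A + B) | v <- s] = 0%N.
  by rewrite count_map; apply: count_pred0.
rewrite e p0 in h1 h2; rewrite addr0.
have [/h1 //|n1] := pselect ((0%:Z, (count (fun x => ~~ is_inl x)
  [seq (inr v.2 : A + B) | v <- s])%:Z) = (n.+1%:Z - j%:Z, j%:Z - 1 + 1)).
by rewrite h2 // => -[h _]; move: hj h; lia.
Qed.

Lemma mhom_bound (f : mhom V V) : exists N : nat, forall s, (N < size s)%N -> f s = 0.
Proof. by have /asboolP[] : is_mhom f := valP f. Qed.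

(** For [f] homogeneous of degree n, its component in C^{n+1-j|j-1}: [j] - 1
    inputs from B when the value is in A, and [j] of them when it is in B. *)
Definition bcomp (f : seq V -> V) (j : nat) (s : seq V) : V :=
  (if j is j'.+1 then (bpart j' f s).1 else 0, (bpart j f s).2).

Lemma bcomp_is_mhom (f : mhom V V) j : is_mhom (bcomp f j).
Proof.
have fl := mhom_multilinear f; have [N fN] := mhom_bound f.
apply/asboolP; split.
- by rewrite /bcomp; case: j => [|j]; rewrite /= mhom_nil ?if_same.
- move=> s t a u v; rewrite /bcomp (bpart_multilinear j fl).
  case: j => [|j]; rewrite ?(bpart_multilinear j fl); congr pair => //=.
  by rewrite scaler0 addr0.
- exists N => s hs; rewrite /bcomp; have z q : bpart q f s = 0.
    by apply: bpart_eq0 => r e; apply: fN; rewrite e.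
  by case: j => [|j]; rewrite !z.
Qed.

Lemma bcomp_inC (f : mhom V V) (n j : nat) : mhom_homog n f -> (j < n.+2)%N ->
  inC (n.+1%:Z - j%:Z) (j%:Z - 1) (Mhom (bcomp_is_mhom f j)).
Proof.
move=> fn hj; have fl := mhom_multilinear f; split.
  move=> s hs /=; rewrite /bcomp; have z q : bpart q f s = 0.
    apply: bpart_eq0 => r e; apply: fn; rewrite e; apply: contra hs => /eqP ->.
    by rewrite addrA !subrK intS [1 + _]addrC.
  by case: j {hs hj} => [|j]; rewrite !z.
move=> w; set p := count _ w; set q := count _ w => /=.
have hw : (p + q = size w)%N by rewrite -(count_predC (fun x => is_inl x) w).
rewrite /bcomp !bpart_emb // -/q.
have [e|ne] := eqVneq (p + q)%N n.+1; last first.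
  have z : f [seq emb x | x <- w] = 0 by apply: fn; rewrite size_map -hw; lia.
  rewrite z; case: j {hj} => [|j]; rewrite ?bpart_emb // ?z ?if_same; by split.
case: j hj => [|j] hj; rewrite ?bpart_emb // -/q.
  split=> [[h1 h2]|[h1 h2]|h1 h2]; [by case: eqP => //; lia|by []|].
  case: eqP => // e0; case: h2; congr pair; lia.
split=> [[h1 h2]|[h1 h2]|h1 h2] /=; try by case: eqP => //; lia.
case: eqP => [e0|_]; first by case: h1; congr pair; lia.
case: eqP => [e0|//]; by case: h2; congr pair; lia.
Qed.

Lemma Bclosed_inQn (f : mhom V V) n : mhom_homog n%:Z f -> Bclosed f -> inQn n f.
Proof.
move=> fn fB; have fl := mhom_multilinear f.
exists (fun j => Mhom (bcomp_is_mhom f j)); split.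
  by move=> j hj; exact: bcomp_inC.
apply: mhom_eq => s; rewrite mhom_sumE pair_sum /=.
rewrite [LHS]surjective_pairing.
have sum_fst (I : Type) (r : seq I) (F : I -> V) :
    \sum_(i <- r) (F i).1 = (\sum_(i <- r) F i).1 by rewrite pair_sum.
have sum_snd (I : Type) (r : seq I) (F : I -> V) :
    \sum_(i <- r) (F i).2 = (\sum_(i <- r) F i).2 by rewrite pair_sum.
have [hs|hs] := eqVneq (size s) n.+1; last first.
  have z q : bpart q f s = 0.
    by apply: bpart_eq0 => r e; apply: fn; rewrite e addrC -intS.
  rewrite fn; last by rewrite addrC -intS.
  by congr pair; rewrite big1 // => -[|j] _; rewrite ?z.
rewrite sum_snd sum_bpart ?hs //; congr pair.
(* all A-valued parts occur but the one with n + 1 inputs from B, which is 0 *)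
rewrite big_nat_recl //= add0r sum_fst -[LHS]subr0.
rewrite -(@sum_bpart _ _ _ _ f s n.+1) ?hs // big_nat_recr //=.
rewrite -hs bpart_size fB ?addr0 ?subr0 //.
by apply/allP => v /mapP[v' _ ->].
Qed.

Lemma Bclosed_inQ (f : mhom V V) : Bclosed f -> inQ f.
Proof.
(* the component with the largest number of inputs is split off *)
have [N fN] := mhom_bound f; elim: N f fN => [|N ih] f fN fB.
  suff -> : f = 0 by exact: (inQ_submod_closed A B).1.
  by apply: mhom_eq => -[|v s]; [exact: mhom_nil|exact: fN].
have -> : f = mhom_comp N f + (f - mhom_comp N f) by rewrite addrC subrK.
have cB : Bclosed (mhom_comp N f).
  by move=> s hs /=; case: ifP => // _; exact: fB.
have cQ : inQ (mhom_comp N f).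
  apply/asboolP; exists [:: mhom_comp N f]; rewrite big_seq1; split=> // g.
  rewrite inE => /eqP ->; exists N; apply: Bclosed_inQn => // s hs /=.
  by rewrite (negbTE hs).
rewrite -[X in X + _]scale1r; apply: (inQ_submod_closed A B).2 => //.
apply: ih => [s hs|s hs].
  rewrite -[LHS]/(f s - mhom_comp N f s) /=; case: eqP => [_|e].
    by rewrite subrr.
  rewrite fN ?subr0 // ltn_neqAle hs andbT; apply/eqP => h; apply: e.
  by rewrite -h addrC -intS.
by rewrite -[LHS]/((f s).1 - (mhom_comp N f s).1) fB // cB // subr0.
Qed.

Lemma bracket_Bclosed (f g : seq V -> V) : Bclosed f -> Bclosed g ->
  Bclosed (bracket f g).
Proof.
have dB f' g' p q : Bclosed f' -> Bclosed g' -> Bclosed (diamond f' g' p q).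
  move=> fB gB s hs; rewrite /diamond pair_sum /= big1 // => i _.
  rewrite fB ?scaler0 // all_cat /= gB ?eqxx /=; last first.
    by apply/allP => v /mem_take /mem_drop; exact: (allP hs).
  by apply/andP; split; apply/allP => v; [move/mem_take|move/mem_drop];
     exact: (allP hs).
move=> fB gB s hs; rewrite /bracket pair_sum /= big1 // => p _.
by rewrite !dB // scaler0 subr0.
Qed.

Lemma Q_Bclosed (F : Q A B) : Bclosed F.
Proof. by apply: inQ_Bclosed; exact: (valP F). Qed.

(** The bracket of Q. *)
Definition Q_bracket (F G : Q A B) : Q A B :=
  MkQ (Bclosed_inQ (bracket_Bclosed (@Q_Bclosed F) (@Q_Bclosed G)
    : Bclosed (mhom_bracket F G))).

Section Sign.
Context (U W : lmodType K).

Lemma mhom_sign_is_mhom (f : mhom U W) :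
  is_mhom (fun s => (-1) ^+ (size s).+1 *: f s).
Proof.
case: f => f /= /asboolP[f0 fl [M fM]]; apply/asboolP; split.
- by rewrite f0 scaler0.
- by move=> s t a u v; rewrite !size_cat /= fl; linear_eq K.
- by exists M => s hs; rewrite fM // scaler0.
Qed.

(** Multiplication of the degree d part by (-1)^d; a word of length d + 1 gets
    the sign (-1)^(d + 2). *)
Definition mhom_sign (f : mhom U W) : mhom U W := Mhom (mhom_sign_is_mhom f).

Lemma mhom_signP a f g : mhom_sign (a *: f + g) = a *: mhom_sign f + mhom_sign g.
Proof.
apply: mhom_eq => s; pose c : K := (-1) ^+ (size s).+1.
rewrite -[LHS]/(c *: (a *: f s + g s)) -[RHS]/(a *: (c *: f s) + c *: g s).
linear_eq K.
Qed.

Lemma mhom_sign_homog d f : mhom_homog d f -> mhom_sign f = sgn K d *: f.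
Proof.
move=> fd; apply: mhom_eq => s; rewrite -[RHS]/(sgn K d *: f s) /=.
have [e|/fd ->] := eqVneq (size s)%:Z (d + 1); last by rewrite !scaler0.
congr (_ *: _); rewrite -sgn_nat -addn1 PoszD sgnD e sgnD sgn1; ring.
Qed.

End Sign.

Lemma mhom_sign_Bclosed (F : Q A B) : Bclosed (mhom_sign F).
Proof. by move=> s hs /=; rewrite Q_Bclosed // scaler0. Qed.

Definition Q_sign (F : Q A B) : Q A B := MkQ (Bclosed_inQ (@mhom_sign_Bclosed F)).

Lemma extend_is_mhom (f : mhom A B) : is_mhom (extend f).
Proof.
case: f => f /= /asboolP[f0 fl [M fM]]; apply/asboolP; split.
- by rewrite /extend f0.
- move=> s t a u v; rewrite /extend !map_cat /= fl; congr pair.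
  by rewrite /= scaler0 addr0.
- by exists M => s hs; rewrite /extend fM // size_map.
Qed.

Lemma extend_Bclosed (f : mhom A B) : Bclosed (Mhom (extend_is_mhom f)).
Proof. by []. Qed.

(** The inclusion of a into Q, by extension by zero. *)
Definition Q_extend (f : mhom A B) : Q A B := MkQ (Bclosed_inQ (@extend_Bclosed f)).

Lemma P_is_mhom (F : mhom V V) : is_mhom (P F).
Proof.
case: F => f /= /asboolP[f0 fl [M fM]]; apply/asboolP; split.
- by rewrite /P f0.
- move=> s t a u v; rewrite /P !map_cat /=.
  have -> : (a *: u + v, 0) = a *: (u, 0) + (v, 0) :> V.
    by congr pair; rewrite /= scaler0 addr0.
  by rewrite fl.
- by exists M => s hs; rewrite /P fM // size_map.
Qed.

(** The projection P of Q onto a. *)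
Definition Q_proj (F : Q A B) : mhom A B := Mhom (P_is_mhom F).

Lemma Q_eq (F G : Q A B) : (forall s, F s = G s) -> F = G.
Proof. by move=> e; apply: val_inj; apply: mhom_eq. Qed.

Lemma Q_bracketPl a X Y Z :
  Q_bracket (a *: X + Y) Z = a *: Q_bracket X Z + Q_bracket Y Z.
Proof. by apply: val_inj; exact: (mhom_bracketPl a (X : mhom V V) Y Z). Qed.

Lemma Q_bracketPr a X Y Z :
  Q_bracket Z (a *: X + Y) = a *: Q_bracket Z X + Q_bracket Z Y.
Proof. by apply: val_inj; exact: (mhom_bracketPr a (X : mhom V V) Y Z). Qed.

Lemma Q_bracket_homog m n X Y :
  Q_homog m X -> Q_homog n Y -> Q_homog (m + n) (Q_bracket X Y).
Proof. exact: mhom_bracket_homog. Qed.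

Lemma Q_bracket_anti m n X Y : Q_homog m X -> Q_homog n Y ->
  Q_bracket X Y = - (sgn K (m * n) *: Q_bracket Y X).
Proof. by move=> hX hY; apply: val_inj; exact: (mhom_bracket_anti hX hY). Qed.

Lemma Q_bracket_jacobi m n p X Y Z : Q_homog m X -> Q_homog n Y -> Q_homog p Z ->
  Q_bracket (Q_bracket X Y) Z =
    Q_bracket X (Q_bracket Y Z) + sgn K (n * p) *: Q_bracket (Q_bracket X Z) Y.
Proof. by move=> hX hY hZ; apply: val_inj; exact: (mhom_bracket_jacobi hX hY hZ). Qed.

Lemma Q_signP a X Y : Q_sign (a *: X + Y) = a *: Q_sign X + Q_sign Y.
Proof. by apply: val_inj; exact: (mhom_signP a (X : mhom V V) Y). Qed.

Lemma Q_sign_homog d X : Q_homog d X -> Q_sign X = sgn K d *: X.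
Proof. by move=> hX; apply: val_inj; exact: (mhom_sign_homog hX). Qed.

Lemma Q_extendP a f g : Q_extend (a *: f + g) = a *: Q_extend f + Q_extend g.
Proof.
apply: Q_eq => s; rewrite -[RHS]/(a *: extend f s + extend g s) /= /extend.
by congr pair; rewrite /= scaler0 addr0.
Qed.

Lemma Q_projP a X Y : Q_proj (a *: X + Y) = a *: Q_proj X + Q_proj Y.
Proof. by apply: mhom_eq. Qed.

Lemma Q_extend_homog d f : mhom_homog d f -> Q_homog d (Q_extend f).
Proof. by move=> fd s hs; rewrite /= /extend fd // size_map. Qed.

Lemma Q_proj_homog d X : Q_homog d X -> mhom_homog d (Q_proj X).
Proof. by move=> hX s hs; rewrite /= /P hX // size_map. Qed.

(** The subspace a is abelian: a value in B fed to a map that only reads A. *)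
Lemma Q_bracket_extend f g : Q_bracket (Q_extend f) (Q_extend g) = 0.
Proof.
have d0 (f' g' : mhom A B) p q s : diamond (extend f') (extend g') p q s = 0.
  rewrite /diamond big1 // => i _; rewrite /extend map_cat /=.
  by rewrite (multilinear0 _ _ (mhom_multilinear f')) (_ : (0, 0) = 0) // scaler0.
apply: Q_eq => s; rewrite /= /bracket big1 // => p _.
by rewrite !d0 scaler0 subr0.
Qed.

(** On words in A, the value of the inner map is split into its components. *)
Lemma P_diamond (F G : mhom V V) p q (s : seq A) :
  (diamond F G p q [seq (a, 0) | a <- s]).2 =
  (diamond F (extend (P G)) p q [seq (a, 0) | a <- s]).2 +
  (diamond (extend (P F)) G p q [seq (a, 0) | a <- s]).2.
Proof.
rewrite /diamond !pair_sum /= -big_split; apply: eq_bigr => i _ /=.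
rewrite -scalerDr; congr (_ *: _); rewrite /extend /P.
have m1 (r : seq A) : [seq v.1 | v <- [seq (a, 0 : B) | a <- r]] = r.
  by rewrite -map_comp map_id_in.
rewrite -!map_take -!map_drop -!map_take !m1 map_cat /= !m1 map_cat /=.
set u := map _ (take i s); set t := map _ (drop (i + _) s).
set y := G _; have := mhom_multilinear F u t 1 (0, y.2) (y.1, 0).
rewrite !scale1r => /(congr1 snd) /= <-; congr (F (_ ++ _ :: _)).2.
by case: y => a b; congr pair; rewrite /= ?addr0 ?add0r.
Qed.

Lemma Q_proj_bracket X Y :
  Q_proj (Q_bracket X Y) =
  Q_proj (Q_bracket X (Q_extend (Q_proj Y))) +
    Q_proj (Q_bracket (Q_extend (Q_proj X)) Y).
Proof.
apply: mhom_eq => s; rewrite -[RHS]/(P (bracket X (extend (P Y))) s +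
  P (bracket (extend (P X)) Y) s) /= /P /bracket !pair_sum /= -big_split.
apply: eq_bigr => p _ /=; rewrite (P_diamond X) (P_diamond Y); linear_eq K.
Qed.

End Q.

(** * The L-infinity algebra *)

(** Discharges the linearity assumptions of the derived brackets of Q. *)
Ltac Q_linearity :=
  try first [ exact: Q_bracketPl | exact: Q_bracketPr | exact: Q_signP
            | exact: mhom_signP | exact: Q_projP | exact: Q_extendP ].

Theorem theorem5p6 (K : fieldType) (charK : [pchar K] =i pred0)
    (A B : lmodType K) :
  exists l : seq (Qa A B) -> Qa A B,
  [/\ Linfty_algebra (Qa_grading A B) l,
      (* l_1(F[1], f) = P(F) *)
      forall (F : Q A B) (f : mhom A B),
        homogeneous (Q_grading A B) F -> homogeneous (mhom_grading A B) f ->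
        let r := l [:: (F, f)] in
        r.1 = 0 /\ r.2 = P F :> (seq A -> B),
      (* l_2(F[1], G[1]) = (-1)^|F| [F, G][1] *)
      forall (m n : int) (F G : Q A B),
        Q_grading A B m F -> Q_grading A B n G ->
        let r := l [:: (F, 0); (G, 0)] in
        r.1 = (-1) ^ m *: bracket F G :> (seq (A * B) -> A * B) /\ r.2 = 0,
      (* l_k(F[1], f_1, ..., f_{k-1}) = P[...[F, f_1], ..., f_{k-1}], k >= 2 *)
      forall (F : Q A B) (fs : seq (mhom A B)),
        homogeneous (Q_grading A B) F ->
        (forall f, f \in fs -> homogeneous (mhom_grading A B) f) ->
        (0 < size fs)%N ->
        let r := l ((F, 0) :: [seq (0, f) | f <- fs]) in
        r.1 = 0 /\
        r.2 = P (foldl (fun H (f : mhom A B) => bracket H (extend f)) F fs) :> (seq A -> B)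
    & (* the components of l on p entries in Q[1] and q entries in a, in any
         order, vanish unless p = 1 or (p, q) = (2, 0) *)
      forall w : seq (Q A B + mhom A B), (0 < size w)%N ->
        let p := count (fun x => is_inl x) w in
        let q := count (fun x => ~~ is_inl x) w in
        p != 1%N -> (p, q) != (2, 0)%N -> l [seq emb x | x <- w] = 0].
Proof.
exists (@derived_bracket K (Q A B) (mhom A B) (@Q_bracket K A B) (@Q_sign K A B)
  (@mhom_sign K A B) (@Q_proj K A B) (@Q_extend K A B)).
have brQZ c (F G : Q A B) : Q_bracket (c *: F) G = c *: Q_bracket F G.
  exact: (@linear_scale _ _ _ (fun X => Q_bracket X G) _ _ (fun a X Y => Q_bracketPl a X Y G)).
split.
- apply: derived_bracket_Linfty.
  + exact: Q_bracketPl.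
  + exact: Q_bracketPr.
  + exact: Q_signP.
  + exact: mhom_signP.
  + exact: Q_projP.
  + exact: Q_extendP.
  + exact: Q_bracket_homog.
  + exact: Q_bracket_anti.
  + exact: Q_bracket_jacobi.
  + exact: Q_sign_homog.
  + exact: mhom_sign_homog.
  + exact: Q_proj_homog.
  + exact: Q_extend_homog.
  + exact: Q_bracket_extend.
  + exact: Q_proj_bracket.
- by move=> F f _ _; rewrite derived_bracket1 //; exact: Q_bracketPr.
- move=> m n F G hF _; rewrite derived_bracket_inl2; Q_linearity.
  by rewrite (Q_sign_homog hF) brQZ.
- move=> F fs _ _ _.
  have -> : (F, 0) :: [seq (0, f) | f <- fs] =
      [seq emb x | x <- inl F :: [seq inr f | f <- fs]] by rewrite /= -map_comp.
  rewrite derived_bracket_inl; Q_linearity.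
  split=> //=; congr P.
  elim: fs (F) => //= f fs ih G; exact: (ih (Q_bracket G (Q_extend f))).
- move=> w _ p q hp hq; apply: derived_bracket_emb_word0 => //; Q_linearity.
Qed.
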